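(* The subgroup $S_{\mathrm{TM}}$ of (real) symplectic tree maps is a closed Lie subgroup of the Butcher group $G_{\mathrm{TM}}$. Moreover, this structure turns $S_{\mathrm{TM}}$ into an exponential Baker--Campbell--Hausdorff Lie group.
   Context: Trees: A rooted tree is a non-empty connected finite graph without cycles with a distinguished node (the root); rooted trees are identified if they are isomorphic via a root-preserving graph isomorphism. $\mathcal T$ is the (countable) set of all rooted trees, $\emptyset$ is the empty tree, $\mathcal T_0=\mathcal T\cup\{\emptyset\}$. An ordered subtree of $\tau\in\mathcal T_0$ is a subset $s$ of the vertices of $\tau$ that is connected by edges of $\tau$ and, if non-empty, contains the root of $\tau$; $\mathrm{OST}(\tau)$ is the set of all ordered subtrees. For $s\in\mathrm{OST}(\tau)$, $s_\tau$ is the rooted tree with vertex set $s$ and root and edges induced by $\tau$ ($s_\tau=\emptyset$ if $s=\emptyset$), and $\tau\setminus s$ is the forest (finite collection, with multiplicity, of rooted trees) obtained from $\tau$ by removing $s$ and its adjacent edges. Butcher group: $G_{\mathrm{TM}}=\{a:\mathcal T_0\to\mathbb R\mid a(\emptyset)=1\}$ with multiplication $$(a\cdot b)(\tau)=\sum_{s\in \mathrm{OST}(\tau)} b(s_\tau)\,a(\tau\setminus s),\qquad a(\tau\setminus s)=\prod_{\theta\in\tau\setminus s}a(\theta)$$ (empty product $=1$). The identity is $e$ with $e(\emptyset)=1$, $e(\tau)=0$ for $\tau\in\mathcal T$. $\mathbb R^{\mathcal T}$ is identified with $\{a\in\mathbb R^{\mathcal T_0}\mid a(\emptyset)=0\}$,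 and carries the topology of pointwise convergence (a Fréchet space). $G_{\mathrm{TM}}=e+\mathbb R^{\mathcal T}$ is a real analytic Lie group (in the sense of Bastiani calculus: maps are $C^r$ if iterated directional derivatives of order $\le r$ exist and are jointly continuous; real analytic if they extend holomorphically to an open neighbourhood in the complexification) modelled on $\mathbb R^{\mathcal T}$ with the global chart $a\mapsto a-e$. Symplectic tree maps: for $u,v\in\mathcal T$, the Butcher product $u\circ v$ is the rooted tree obtained by adding an edge between the root of $v$ and the root of $u$, with the root of $u$ as root. $S_{\mathrm{TM}}$ is the set of all $a\in G_{\mathrm{TM}}$ with $a(u\circ v)+a(v\circ u)-a(u)a(v)=0$ for all $u,v\in\mathcal T$; it is a subgroup of $G_{\mathrm{TM}}$. Conventions: a closed Lie subgroup of a Lie group $G$ is a closed subgroup that is a submanifold of $G$ (modelled on a closed vector subspace of the model space), with the induced Lie group structure. A Lie group is exponential if its exponential map $\exp:\mathbf L(H)\to H$ (time-1 value of the solution of $\eta'(t)=T_{\mathbf 1}\rho_{\eta(t)}(v)$, $\eta(0)=\mathbf 1$, $\rho_g(x)=xg$) is a global diffeomorphism; it is a Baker--Campbell--Hausdorff Lie group if it is an analytic Lie group whose exponential map is an analytic local diffeomorphism (at $0$); for an exponential BCH group here, $\exp$ and its inverse are analytic. *)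

(* Defs.v *)
From HB Require Import structures.
From mathcomp Require Import all_boot all_order all_algebra.
From mathcomp Require Import generic_quotient complex.
From mathcomp Require Import all_classical all_reals all_analysis.

Set Implicit Arguments.
Unset Strict Implicit.
Unset Printing Implicit Defensive.

Import Order.TTheory GRing.Theory Num.Theory.
Import numFieldNormedType.Exports.

Local Open Scope classical_set_scope.
Local Open Scope ring_scope.
Local Open Scope quotient_scope.

(** * Rooted trees *)

(* Finite graphs with a distinguished vertex.  The vertex set may be a proper
   subset of 'I_gsize, so that induced subgraphs need no relabelling. *)
Record rgraph := RGraph {
  gsize : nat;
  vertices : {set 'I_gsize};
  (* not [rel 'I_gsize], whose universe is too large for [choiceType] *)
  edge : 'I_gsize -> 'I_gsize -> bool;
  root : 'I_gsize
}.

Definition edge_in (g : rgraph) (A : {set 'I_(gsize g)}) : rel 'I_(gsize g) :=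
  fun x y => [&& edge x y, x \in A & y \in A].

Definition connected_in (g : rgraph) (A : {set 'I_(gsize g)}) : bool :=
  [forall x in A, forall y in A, connect (edge_in A) x y].

(* A [ucycle] of size 2 runs back and forth along one edge; the cycles of a
   simple graph are the [ucycle]s of size at least 3. *)
Definition is_tree (g : rgraph) : bool :=
  [&& root g \in vertices g,
      [forall x, forall y, edge x y ==>
         [&& x \in vertices g, y \in vertices g, x != y & @edge g y x]],
      connected_in (vertices g) &
      `[< forall p : seq 'I_(gsize g), ucycle (@edge g) p -> (size p < 3)%N >]].

Definition iso_graph (g h : rgraph) : Prop :=
  exists f : 'I_(gsize g) -> 'I_(gsize h),
    [/\ f @: vertices g = vertices h,
        {in vertices g &, injective f}, f (root g) = root h &
        {in vertices g &, forall x y, edge (f x) (f y) = edge x y}].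

Lemma iso_graph_refl g : iso_graph g g.
Proof. by exists id; split => //; rewrite imset_id. Qed.

Lemma iso_graph_sym g h :
  root g \in vertices g -> iso_graph g h -> iso_graph h g.
Proof.
move=> rV [f [fV finj fr fE]].
pose k y := odflt (root g) [pick x in vertices g | f x == y].
have kf : {in vertices g, cancel f k}.
  move=> x xV; rewrite /k; case: pickP => [z /andP[zV /eqP]|/(_ x)].
    exact: finj.
  by rewrite xV eqxx.
have fim y : y \in vertices h -> exists2 x, x \in vertices g & y = f x.
  by rewrite -fV => /imsetP[x xV ->]; exists x.
exists k; split.
- apply/setP => x; apply/imsetP/idP => [[y /fim[z zV ->] ->]|xV].
    by rewrite kf.
  by exists (f x); rewrite ?kf// -fV imset_f.
- by move=> _ _ /fim[x xV ->] /fim[y yV ->]; rewrite !kf// => ->.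
- by rewrite -fr kf.
- by move=> _ _ /fim[x xV ->] /fim[y yV ->]; rewrite !kf// fE.
Qed.

Lemma iso_graph_trans g h k : iso_graph g h -> iso_graph h k -> iso_graph g k.
Proof.
move=> [f [fV finj fr fE]] [f' [fV' finj' fr' fE']].
have fim x : x \in vertices g -> f x \in vertices h.
  by move=> xV; rewrite -fV imset_f.
exists (f' \o f); split.
- by rewrite imset_comp fV fV'.
- by move=> x y xV yV /= /finj' e; apply: finj => //; apply: e; exact: fim.
- by rewrite /= fr.
- by move=> x y xV yV /=; rewrite fE' ?fim// fE.
Qed.

Record gtree := GTree { graph_of :> rgraph; _ : is_tree graph_of }.
HB.instance Definition _ := [isSub for graph_of].
HB.instance Definition _ := gen_eqMixin gtree.
HB.instance Definition _ := gen_choiceMixin gtree.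

Definition iso_tree : rel gtree := fun t u => `[< iso_graph t u >].

Lemma iso_tree_refl : reflexive iso_tree.
Proof. by move=> t; apply/asboolP/iso_graph_refl. Qed.

Lemma iso_tree_sym : symmetric iso_tree.
Proof.
have s t u : iso_tree t u -> iso_tree u t.
  move=> /asboolP tu; apply/asboolP; apply: iso_graph_sym => //.
  by case: t {tu} => t /= /andP[].
by move=> t u; apply/idP/idP; exact: s.
Qed.

Lemma iso_tree_trans : transitive iso_tree.
Proof.
by move=> u t v /asboolP tu /asboolP uv; apply/asboolP/(iso_graph_trans tu uv).
Qed.

Canonical iso_tree_equiv :=
  EquivRel iso_tree iso_tree_refl iso_tree_sym iso_tree_trans.
Canonical iso_tree_encModRel := defaultEncModRel iso_tree.

Definition rtree := {eq_quot iso_tree}.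
HB.instance Definition _ := EqQuotient.on rtree.
HB.instance Definition _ := Choice.on rtree.

(* [None] is the empty tree. *)
Definition rtree0 := option rtree.

(* The isomorphism class of a graph, read as the empty tree if the graph is not
   a tree; below this is only used for trees and for the graph without vertices
   (see [is_tree_induced] and [connected_component]). *)
Definition tree_class (g : rgraph) : rtree0 :=
  omap (fun t : gtree => \pi_rtree t) (insub g).

Definition induced (g : rgraph) (A : {set 'I_(gsize g)}) (v : 'I_(gsize g)) :
    rgraph :=
  @RGraph (gsize g) A (edge_in A) v.

Lemma is_tree_induced (t : gtree) (A : {set 'I_(gsize t)}) (v : 'I_(gsize t)) :
  v \in A -> connected_in A -> is_tree (induced A v).
Proof.
case: t A v => t /= /and4P[_ /'forall_forallP tE _ /asboolP tC] A v vA cA.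
apply/and4P; split => //=.
- apply/'forall_forallP => x y; apply/implyP => /and3P[xy xA yA] /=.
  move: (tE x y); rewrite xy /= => /and4P[_ _ nxy yx].
  by rewrite xA yA nxy /edge_in yx xA yA.
- apply/'forall_in_'forall_in_idP => x xA y yA.
  move/'forall_in_'forall_in_idP: cA => /(_ x xA y yA).
  by apply: connect_sub => a b ab; apply: connect1; case/and3P: (ab) => ? ? ?;
     rewrite /edge_in /= ab; apply/and3P.
- apply/asboolP => p /andP[pc pu]; apply: tC; apply/andP; split => //.
  by move: pc; apply: sub_cycle => a b /and3P[].
Qed.

(* A non-empty s has induced tree [induced s (root g)]; the graph
   [induced set0 (root g)] is not a tree, so its class is the empty tree. *)
Definition ordered_subtree (g : rgraph) (s : {set 'I_(gsize g)}) : bool :=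
  [&& s \subset vertices g, connected_in s &
      (s != finset.set0) ==> (root g \in s)].

Definition component (g : rgraph) (A : {set 'I_(gsize g)}) (v : 'I_(gsize g)) :
    {set 'I_(gsize g)} :=
  [set w in A | connect (edge_in A) v w]%SET.

Lemma connected_component (g : rgraph) (A : {set 'I_(gsize g)}) v :
  symmetric (@edge g) -> v \in A -> connected_in (component A v).
Proof.
move=> gsym vA; pose C := component A v.
have esym (B : {set 'I_(gsize g)}) : symmetric (edge_in B).
  by move=> x y; rewrite /edge_in gsym [(y \in B) && _]andbC.
have inC z : connect (edge_in A) v z -> z \in C.
  move=> vz; rewrite inE vz andbT; case/connectP: vz => p vp ->.
  elim/last_ind: p vp => //= p w _; rewrite rcons_path last_rcons.
  by case/andP => _ /and3P[].
have vC x : x \in C -> connect (edge_in C) v x.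
  rewrite inE => /andP[xA /connectP[p vp ->]]; apply/connectP; exists p => //.
  apply: (@sub_in_path _ (mem C) (edge_in A)) (vp).
    by move=> y z yC zC /and3P[yz _ _]; apply/and3P.
  by apply/allP => z /(path_connect vp)/inC.
apply/'forall_in_'forall_in_idP => x xC y yC.
apply: connect_trans (vC y yC).
by rewrite (sym_connect_sym (esym _)) vC.
Qed.

(* The roots of the trees of the forest g \ s: the vertices outside s that are
   adjacent to s, and the root of g itself in case s is empty. *)
Definition cut_roots (g : rgraph) (s : {set 'I_(gsize g)}) :
    {set 'I_(gsize g)} :=
  [set v in vertices g :\: s |
    (v == root g) || [exists w in s, edge w v]]%SET.

Definition butcher_graph (g h : rgraph) : rgraph :=
  @RGraph (gsize g + gsize h)
    ([set lshift (gsize h) x | x in vertices g] :|: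
     [set rshift (gsize g) y | y in vertices h])%SET
    (fun x y => match fintype.split x, fintype.split y with
      | inl x', inl y' => edge x' y'
      | inr x', inr y' => edge x' y'
      | inl x', inr y' => (x' == root g) && (y' == root h)
      | inr x', inl y' => (y' == root g) && (x' == root h)
      end)
    (lshift (gsize h) (root g)).

(* the Butcher product u o v *)
Definition butcher (u v : rtree) : rtree0 :=
  tree_class (butcher_graph (repr u) (repr v)).

(** * Tree maps *)

Section TreeMaps.
Variable K : comNzRingType.

(* The empty tree has the empty set as only ordered subtree, and the
   corresponding forest is empty. *)
Definition tm_mul (a b : rtree0 -> K) (t : rtree0) : K :=
  match t with
  | None => b None
  | Some t => let g : rgraph := repr t in
      \sum_(s : {set 'I_(gsize g)} | ordered_subtree s)
        b (tree_class (induced s (root g))) *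
        \prod_(v in cut_roots s)
          a (tree_class (induced (component (vertices g :\: s) v) v))
  end.

Definition tm_one (t : rtree0) : K := (t == None)%:R.

Definition G_TM : set (rtree0 -> K) := [set a | a None = 1].

(* R^T, as a subspace of R^T_0 *)
Definition tm_model : set (rtree0 -> K) := [set a | a None = 0].

Definition S_TM : set (rtree0 -> K) :=
  [set a | G_TM a /\ forall u v : rtree,
    a (butcher u v) + a (butcher v u) - a (Some u) * a (Some v) = 0].

End TreeMaps.

(** * Bastiani calculus *)

(* The locally convex spaces are the closed vector subspaces F of the spaces
   K^I of families [I -> K], which carry the pointwise operations and the
   topology of pointwise convergence.  Maps are total functions on K^I, of
   which only the values on the stated domains matter. *)
Import ArrowAsProduct.

Definition open_in (T : topologicalType) (A U : set T) : Prop :=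
  exists2 O : set T, open O & U = A `&` O.

Definition closed_in (T : topologicalType) (A B : set T) : Prop :=
  exists2 C : set T, closed C & B = A `&` C.

Section Calculus.
Variable K : numFieldType.

Definition closed_subspace (I : Type) (F : set (I -> K)) : Prop :=
  [/\ closed F, F 0 & forall (h : K) x y, F x -> F y -> F (h *: x + y)].

Definition diff_quot (I J : Type) (f : (I -> K) -> (J -> K)) (v x : I -> K)
    (h : K) : J -> K :=
  h^-1 *: (f (x + h *: v) - f x).

(* the directional derivative; a default value if the limit does not exist *)
Definition dderiv (I J : Type) (f : (I -> K) -> (J -> K)) (v x : I -> K) :
    J -> K :=
  get [set l : J -> K | diff_quot f v x @ 0^' --> l].

(* D_(v_k) ... D_(v_1) f for vs = [:: v_1; ...; v_k] *)
Fixpoint iter_dderiv (I J : Type) (f : (I -> K) -> (J -> K))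
    (vs : seq (I -> K)) : (I -> K) -> (J -> K) :=
  if vs is v :: vs' then iter_dderiv (dderiv f v) vs' else f.

(* f is C^oo on the relatively open subset U of F: all iterated directional
   derivatives exist, and they are jointly continuous on U x F^k. *)
Definition smooth (I J : Type) (F U : set (I -> K))
    (f : (I -> K) -> (J -> K)) : Prop :=
  forall k : nat,
    (forall (x v : I -> K) (vs : 'I_k -> I -> K),
       U x -> F v -> (forall i, F (vs i)) ->
       exists l : J -> K,
         diff_quot (iter_dderiv f (codom vs)) v x @ 0^' --> l) /\
    {within [set p : (I -> K) * ('I_k -> I -> K) |
               U p.1 /\ forall i, F (p.2 i)],
     continuous (fun p => iter_dderiv f (codom p.2) p.1)}.

End Calculus.

(** * Real analytic maps *)

Section Analytic.
Variable R : realType.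

Definition cplx : numFieldType := R[i].

Definition cplx_of (I : Type) (x : I -> R) : I -> cplx :=
  fun i => (x i)%:C%C.

Definition complexify (I : Type) (F : set (I -> R)) : set (I -> cplx) :=
  [set z | F (fun i => complex.Re (z i)) /\ F (fun i => complex.Im (z i))].

(* f : U -> F' is real analytic, for U relatively open in F: it extends to a
   holomorphic map, i.e. a C^oo map over the complex numbers, from an open
   neighbourhood of U in the complexification of F to that of F'. *)
Definition analytic (I J : Type) (F U : set (I -> R)) (F' : set (J -> R))
    (f : (I -> R) -> (J -> R)) : Prop :=
  exists (O : set (I -> cplx)) (g : (I -> cplx) -> (J -> cplx)),
    [/\ open_in (complexify F) O,
        forall x, U x -> O (cplx_of x) /\ g (cplx_of x) = cplx_of (f x),
        forall z, O z -> complexify F' (g z) &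
        smooth (complexify F) O g].

(** * Manifolds *)

(* [cfun] is a bijection, with inverse [cinv], from [cdom] onto a relatively
   open subset of the model space. *)
Record chart (I : Type) := Chart {
  cdom : set (I -> R);
  cfun : (I -> R) -> (I -> R);
  cinv : (I -> R) -> (I -> R)
}.

(* Manifolds are topological subspaces of R^I, modelled on a closed vector
   subspace of R^I; the atlas need not be maximal. *)
Record manifold (I : Type) := Manifold {
  carrier : set (I -> R);
  model : set (I -> R);
  atlas : set (chart I)
}.

(* f is an analytic map from the open subset U of M to N. *)
Definition manifold_map (I J : Type) (M : manifold I) (U : set (I -> R))
    (N : manifold J) (f : (I -> R) -> (J -> R)) : Prop :=
  forall x, U x -> exists (c : chart I) (d : chart J) (W : set (I -> R)),
    [/\ atlas M c, atlas N d,
        [/\ open_in (carrier M) W, W x, W `<=` U & W `<=` cdom c],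
        forall y, W y -> cdom d (f y) &
        analytic (model M) (cfun c @` W) (model N)
                 (fun z => cfun d (f (cinv c z)))].

Definition analytic_diffeo (I J : Type) (M : manifold I) (U : set (I -> R))
    (N : manifold J) (V : set (J -> R))
    (f : (I -> R) -> (J -> R)) (g : (J -> R) -> (I -> R)) : Prop :=
  [/\ forall x, U x -> V (f x) /\ g (f x) = x,
      forall y, V y -> U (g y) /\ f (g y) = y,
      manifold_map M U N f & manifold_map N V M g].

Definition linear_manifold (I : Type) (F : set (I -> R)) : manifold I :=
  Manifold F F [set Chart F id id].

Definition product_fun (I J : Type) (f : (I -> R) -> (I -> R))
    (g : (J -> R) -> (J -> R)) (z : I + J -> R) (k : I + J) : R :=
  match k with inl i => f (z \o inl) i | inr j => g (z \o inr) j end.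

Definition product_set (I J : Type) (A : set (I -> R)) (B : set (J -> R)) :
    set (I + J -> R) :=
  [set z : I + J -> R | A (z \o inl) /\ B (z \o inr)].

Definition product_chart (I J : Type) (c : chart I) (d : chart J) :
    chart (I + J) :=
  Chart (product_set (cdom c) (cdom d))
        (product_fun (cfun c) (cfun d)) (product_fun (cinv c) (cinv d)).

(* R^I x R^J is identified with R^(I + J). *)
Definition product_manifold (I J : Type) (M : manifold I) (N : manifold J) :
    manifold (I + J) :=
  Manifold (product_set (carrier M) (carrier N))
           (product_set (model M) (model N))
           [set e | exists c d,
              [/\ atlas M c, atlas N d & e = product_chart c d]].

(* A chart of the maximal atlas of M that flattens S onto the subspace F. *)
Definition slice_chart (I : Type) (M : manifold I) (S F : set (I -> R))
    (c : chart I) : Prop :=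
  let V := cfun c @` cdom c in
  [/\ open_in (carrier M) (cdom c), open_in (model M) V,
      analytic_diffeo M (cdom c) (linear_manifold (model M)) V
                      (cfun c) (cinv c) &
      cfun c @` (cdom c `&` S) = V `&` F].

Definition submanifold (I : Type) (M : manifold I) (S F : set (I -> R)) :
    Prop :=
  [/\ S `<=` carrier M, closed_subspace F, F `<=` model M &
      forall x, S x -> exists2 c, slice_chart M S F c & cdom c x].

Definition induced_manifold (I : Type) (M : manifold I) (S F : set (I -> R)) :
    manifold I :=
  Manifold S F
    [set Chart (cdom c `&` S) (cfun c) (cinv c) | c in slice_chart M S F].

(* The tangent space at x, as a subspace of R^I: the images of the model space
   under the derivatives of the inverses of charts around x. *)
Definition tangent_space (I : Type) (M : manifold I) (x : I -> R) :
    set (I -> R) :=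
  [set v | exists c, [/\ atlas M c, cdom c x &
     exists2 w, model M w & diff_quot (cinv c) w (cfun c x) @ 0^' --> v]].

(** * Lie groups *)

Section LieGroups.
Variables (I : Type) (mul : (I -> R) -> (I -> R) -> (I -> R)) (one : I -> R).

Definition subgroup (G S : set (I -> R)) : Prop :=
  [/\ S `<=` G, S one, forall a b, S a -> S b -> S (mul a b) &
      forall a, S a -> exists2 b, S b & mul a b = one /\ mul b a = one].

Definition closed_Lie_subgroup (G : manifold I) (S F : set (I -> R)) : Prop :=
  [/\ subgroup (carrier G) S, closed_in (carrier G) S & submanifold G S F].

Definition group_axioms (G : set (I -> R)) (inv : (I -> R) -> (I -> R)) :
    Prop :=
  [/\ G one /\ (forall a b, G a -> G b -> G (mul a b)),
      forall a b c, G a -> G b -> G c -> mul a (mul b c) = mul (mul a b) c,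
      forall a, G a -> mul one a = a /\ mul a one = a &
      forall a, G a -> [/\ G (inv a), mul (inv a) a = one &
                           mul a (inv a) = one]].

Definition analytic_Lie_group (G : manifold I) : Prop :=
  exists inv : (I -> R) -> (I -> R),
    [/\ group_axioms (carrier G) inv,
        let GG := product_manifold G G in
        manifold_map GG (carrier GG) G (fun z => mul (z \o inl) (z \o inr)) &
        manifold_map G (carrier G) G inv].

Definition Lie_algebra (G : manifold I) : set (I -> R) := tangent_space G one.

(* eta' (t) = T rho_(eta t) (v) and eta 0 = one, where rho_g x = x g *)
Definition evolution (G : manifold I) (v : I -> R) (eta : R -> (I -> R)) :
    Prop :=
  [/\ forall t, carrier G (eta t), eta 0 = one &
      forall t, (fun h : R => h^-1 *: (eta (t + h) - eta t)) @ 0^' -->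
                dderiv (fun x => mul x (eta t)) v one].

Definition exponential_map (G : manifold I) (ex : (I -> R) -> (I -> R)) :
    Prop :=
  forall v, Lie_algebra G v ->
    forall a, (exists2 eta, evolution G v eta & eta 1 = a) <-> a = ex v.

Definition BCH_Lie_group (G : manifold I) : Prop :=
  let L := Lie_algebra G in
  analytic_Lie_group G /\
  exists (ex lg : (I -> R) -> (I -> R)) (U V : set (I -> R)),
    [/\ exponential_map G ex, open_in L U /\ U 0, open_in (carrier G) V &
        analytic_diffeo (linear_manifold L) U G V ex lg].

(* The diffeomorphism is required to be analytic together with its inverse. *)
Definition exponential_Lie_group (G : manifold I) : Prop :=
  let L := Lie_algebra G in
  exists ex lg : (I -> R) -> (I -> R),
    exponential_map G ex /\
    analytic_diffeo (linear_manifold L) L G (carrier G) ex lg.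

End LieGroups.

Definition butcher_group : manifold rtree0 :=
  Manifold (@G_TM R) (@tm_model R)
    [set Chart (@G_TM R) (fun a => a - @tm_one R) (fun a => a + @tm_one R)].

End Analytic.

(* Main.v *)
(* The coproduct of a tree u o w is determined by those of u and w (tsum_bt), and
   every tree is a single vertex or some u o w.  Induction on this gives the
   associativity of the product and
     phi (a b) (u, w) = phi a (u, w) + sum_(s, r) phi b (s, r) a(u \ s) a(w \ r)
   for phi a (u, w) = a(u o w) + a(w o u) - a(u) a(w), where s and r run over the
   non-empty ordered subtrees of u and w; hence S_TM is a subgroup.  Taking a to be
   infinitesimal yields the derivative of phi along the equation of the evolution of
   v, whose solution is polynomial in time on each tree: by induction on the trees,
   exp v lies in S_TM if and only if v(u o w) + v(w o u) = 0 for all u and w.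

   On each tree, exp v - e - v only depends on the values of v on smaller trees, so
   that exp is a bijection from R^T onto G_TM, and exp and its inverse log are
   polynomial on each tree.  Thus log is a global chart of G_TM that flattens S_TM;
   in this chart exp and log become the identity, and the product and the inversion
   are polynomial.  All of this holds over every field K with a numFieldType
   structure, and the case K = R[i] provides the holomorphic extensions. *)
From mathcomp Require Import all_boot all_order all_algebra.
From mathcomp Require Import generic_quotient boolp ring complex.
Require Import Defs.

Set Implicit Arguments.
Unset Strict Implicit.
Unset Printing Implicit Defensive.

Import Order.TTheory GRing.Theory Num.Theory.

Local Open Scope ring_scope.
Local Open Scope quotient_scope.

(** * Connected components and ordered subtrees *)

(** The sums over ordered subtrees are treated as operators [tsum a] on functions of trees, so that
    the recursion along [u o w] may change the function during an induction; associativity then says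
    that [tsum] is multiplicative. The infinitesimal element is [e + v X] over a polynomial ring,
    and derivatives are coefficients of [X]; this is why the algebra is done over an arbitrary
    commutative ring. Inverse and logarithm both solve equations [x + N x = y] with [N] strictly
    triangular for the number of vertices, hence are finite iterations.

    Smoothness concerns iterated directional derivatives whose values are limits chosen by [get], so
    polynomial maps are represented by symbolic expressions, in which the directions are additional
    variables. Two notions quantify over more than the explicit data and need their own argument:
    the Lie algebra is defined through all slice charts, and the exponential map demands uniqueness
    among all solutions of the evolution equation. *)

Lemma root_vertex (t : gtree) : root t \in vertices t.
Proof. by case: t => g /= /andP[]. Qed.

Lemma edge_gtree (t : gtree) x y : @edge t x y ->
  [/\ x \in vertices t, y \in vertices t, x != y & @edge t y x].
Proof.
case: t x y => g /= /and4P[_ /'forall_forallP tE _ _] x y xy.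
by have := tE x y; rewrite xy /= => /and4P[].
Qed.

Lemma edge_gtree_sym (t : gtree) : symmetric (@edge t).
Proof. by move=> x y; apply/idP/idP => /edge_gtree[]. Qed.

Lemma connected_gtree (t : gtree) : connected_in (vertices t).
Proof. by case: t => g /= /and4P[]. Qed.

Lemma acyclic_gtree (t : gtree) p : ucycle (@edge t) p -> (size p < 3)%N.
Proof. by case: t p => g /= /and4P[_ _ _ /asboolP]. Qed.

Lemma edge_in_sym (g : rgraph) (A : {set 'I_(gsize g)}) :
  symmetric (@edge g) -> symmetric (edge_in A).
Proof. by move=> gs x y; rewrite /edge_in gs [(y \in A) && _]andbC. Qed.

Lemma component_sub (g : rgraph) (A : {set 'I_(gsize g)}) v :
  component A v \subset A.
Proof. by apply/subsetP => x; rewrite inE => /andP[]. Qed.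

Lemma component_root (g : rgraph) (A : {set 'I_(gsize g)}) v :
  v \in A -> v \in component A v.
Proof. by move=> vA; rewrite inE vA connect0. Qed.

(** The induction principle for components: walks in [A] that start in [C] cannot leave it. Most
    upper bounds for a component below exhibit such a [C]. *)
Lemma component_least (g : rgraph) (A C : {set 'I_(gsize g)}) v :
  symmetric (@edge g) -> v \in C ->
  (forall x y, x \in C -> y \in A -> edge x y -> y \in C) ->
  component A v \subset C.
Proof.
move=> gs vC Cc; apply/subsetP => y; rewrite inE => /andP[_ vy].
have cl : closed (edge_in A) (mem C).
  apply: intro_closed; first exact/sym_connect_sym/edge_in_sym.
  by move=> x z /and3P[xz xA zA] xC; apply: Cc xz.
by rewrite -(closed_connect cl vy).
Qed.

Lemma component_edge (g : rgraph) (A : {set 'I_(gsize g)}) v x y :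
  x \in component A v -> y \in A -> edge x y -> y \in component A v.
Proof.
rewrite !inE => /andP[xA vx] yA xy; rewrite yA (connect_trans vx)//.
by rewrite connect1// /edge_in xy xA.
Qed.

Lemma connected_inE (g : rgraph) (A : {set 'I_(gsize g)}) v :
  symmetric (@edge g) -> v \in A -> connected_in A = (component A v == A).
Proof.
move=> gs vA; apply/idP/eqP => [|<-]; last exact: connected_component.
move=> /'forall_in_'forall_in_idP cA; apply/setP => x; rewrite inE.
by case: (boolP (x \in A)) => //= xA; rewrite cA.
Qed.

Lemma component_connected (g : rgraph) (A : {set 'I_(gsize g)}) v :
  connected_in A -> v \in A -> component A v = A.
Proof.
move=> /'forall_in_'forall_in_idP cA vA; apply/setP => x; rewrite inE.
by case: (boolP (x \in A)) => //= xA; rewrite cA.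
Qed.

Lemma component_map (g h : rgraph) (f : 'I_(gsize g) -> 'I_(gsize h))
    (A : {set 'I_(gsize g)}) (B : {set 'I_(gsize h)}) v :
  symmetric (@edge g) -> f @: A \subset B ->
  {in A &, forall x y, edge x y -> edge (f x) (f y)} ->
  v \in A -> f @: component A v \subset component B (f v).
Proof.
move=> gs fAB fE vA.
have : component A v \subset A :&: f @^-1: component B (f v).
  apply: component_least => //.
    by rewrite inE vA inE component_root// (subsetP fAB)// imset_f.
  move=> x y; rewrite inE => /andP[xA]; rewrite inE => fx yA xy.
  rewrite inE yA inE (component_edge fx) ?fE//.
  by rewrite (subsetP fAB)// imset_f.
move=> /subsetP sAB; apply/subsetP => _ /imsetP[x xC ->].
by have := sAB _ xC; rewrite !inE => /andP[].
Qed.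

(** That the component is not larger than the image rests on the hypothesis that no edge into [B]
    leaves the image of [A]. The lemma serves for isomorphisms and for the two embeddings into a
    Butcher product. *)
Lemma component_transport (g h : rgraph) (f : 'I_(gsize g) -> 'I_(gsize h))
    (A : {set 'I_(gsize g)}) (B : {set 'I_(gsize h)}) v :
  symmetric (@edge g) -> symmetric (@edge h) ->
  {in A &, injective f} -> f @: A \subset B ->
  {in A &, forall x y, edge (f x) (f y) = edge x y} ->
  (forall x y, x \in A -> y \in B -> edge (f x) y -> y \in f @: A) ->
  v \in A -> component B (f v) = f @: component A v.
Proof.
move=> gs hs finj fAB fE fcl vA; apply/eqP; rewrite eqEsubset; apply/andP; split.
  apply: component_least => //; first exact/imset_f/component_root.
  move=> _ y /imsetP[x xC ->] yB xy.
  have xA := subsetP (component_sub A v) _ xC.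
  have /imsetP[z zA zE] := fcl _ _ xA yB xy.
  by rewrite zE imset_f// (component_edge xC)// -fE// -zE.
by apply: component_map => // x y xA yA; rewrite fE.
Qed.

(** Connectedness becomes an equation about the component of the root, which is easy to follow
    through isomorphisms and Butcher products. *)
Lemma ordered_subtreeE (g : rgraph) (s : {set 'I_(gsize g)}) :
  symmetric (@edge g) ->
  ordered_subtree s && (s != set0) =
  [&& s \subset vertices g, root g \in s & component s (root g) == s].
Proof.
move=> gs; rewrite /ordered_subtree; case: (boolP (s == set0)) => [/eqP ->|s0].
  by rewrite andbF inE andbF.
rewrite andbT; congr andb; case: (boolP (root g \in s)) => rs.
  by rewrite andbT (connected_inE gs rs).
by rewrite andbF.
Qed.

Lemma ordered_subtree0 (g : rgraph) :
  ordered_subtree (set0 : {set 'I_(gsize g)}).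
Proof.
rewrite /ordered_subtree sub0set eqxx andbT /=.
by apply/'forall_in_'forall_in_idP => x; rewrite inE.
Qed.

Lemma tree_classE (g : rgraph) (gT : is_tree g) :
  tree_class g = Some (\pi_rtree (GTree gT)).
Proof. by rewrite /tree_class insubT. Qed.

Lemma tree_class_gtree (t : gtree) : tree_class t = Some (\pi_rtree t).
Proof. by case: t => g gT; rewrite (tree_classE gT). Qed.

Lemma pi_iso (t u : gtree) : iso_graph t u -> \pi_rtree t = \pi_rtree u.
Proof. by move=> tu; apply/(@eqmodP _ iso_tree_equiv)/asboolP. Qed.

Lemma iso_repr (t : gtree) : iso_graph (repr (\pi_rtree t)) t.
Proof. by apply/asboolP; apply/(@eqmodP _ iso_tree_equiv); rewrite reprK. Qed.

Lemma tree_class_iso (g h : rgraph) : is_tree g -> is_tree h -> iso_graph g h ->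
  tree_class g = tree_class h.
Proof.
by move=> gT hT gh; rewrite (tree_classE gT) (tree_classE hT); congr Some; apply/pi_iso.
Qed.

Lemma iso_card (g h : rgraph) : iso_graph g h -> #|vertices g| = #|vertices h|.
Proof. by move=> [f [<- finj _ _]]; rewrite card_in_imset. Qed.

Definition tsize (t : rtree0) : nat :=
  if t is Some t then #|vertices (repr t)| else 0.

Lemma tsize_pi (t : gtree) : tsize (Some (\pi_rtree t)) = #|vertices t|.
Proof. exact/iso_card/iso_repr. Qed.

Lemma tsize_gt0 (t : rtree) : (0 < tsize (Some t))%N.
Proof. by apply/card_gt0P; exists (root (repr t)); exact: root_vertex. Qed.

Lemma tsize_class (g : rgraph) : (tsize (tree_class g) <= #|vertices g|)%N.
Proof.
rewrite /tree_class; case: insubP => //= u _ <-.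
by have := tsize_pi u; rewrite /= => ->.
Qed.

Lemma induced_iso (g h : rgraph) (f : 'I_(gsize g) -> 'I_(gsize h))
    (A : {set 'I_(gsize g)}) v :
  {in A &, injective f} -> {in A &, forall x y, edge (f x) (f y) = edge x y} ->
  iso_graph (induced A v) (induced (f @: A) (f v)).
Proof.
move=> finj fE; exists f; split => // x y xA yA /=.
by rewrite /edge_in /= fE// !imset_f// xA yA.
Qed.

Lemma component_tree (t : gtree) (A : {set 'I_(gsize t)}) v :
  v \in A -> is_tree (induced (component A v) v).
Proof.
move=> vA; apply: is_tree_induced; first exact: component_root.
exact/connected_component/vA/edge_gtree_sym.
Qed.

Lemma ordered_tree (t : gtree) (s : {set 'I_(gsize t)}) :
  ordered_subtree s -> s != set0 -> is_tree (induced s (root t)).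
Proof.
move=> /and3P[_ cs /implyP rs] s0; apply: is_tree_induced cs; exact: rs.
Qed.

Lemma cut_rootsP (g : rgraph) (s : {set 'I_(gsize g)}) v :
  v \in cut_roots s -> v \in vertices g :\: s.
Proof. by rewrite inE => /andP[]. Qed.

(** * Sums over ordered subtrees and their invariance under isomorphism *)

Definition forest_prod (A : comNzRingType) (a : rtree0 -> A) (g : rgraph)
    (s : {set 'I_(gsize g)}) : A :=
  \prod_(v in cut_roots s)
    a (tree_class (induced (component (vertices g :\: s) v) v)).

(** For a tree [g] the default value 0 is never reached, since non-empty ordered subtrees induce
    trees ([ordered_tree]). *)
Definition graph_sum (A : comNzRingType) (a : rtree0 -> A) (f : rtree -> A)
    (g : rgraph) : A :=
  \sum_(s : {set 'I_(gsize g)} | ordered_subtree s && (s != set0))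
    oapp f 0 (tree_class (induced s (root g))) * forest_prod a s.

Section GraphIso.
Variables (g h : gtree) (f : 'I_(gsize g) -> 'I_(gsize h)).
Hypotheses (fV : f @: vertices g = vertices h)
  (finj : {in vertices g &, injective f}) (froot : f (root g) = root h)
  (fE : {in vertices g &, forall x y, edge (f x) (f y) = edge x y}).

Let sg := @edge_gtree_sym g.
Let sh := @edge_gtree_sym h.
Let rg := root_vertex g.

Lemma iso_imset_inj (A B : {set 'I_(gsize g)}) :
  A \subset vertices g -> B \subset vertices g -> f @: A = f @: B -> A = B.
Proof.
move=> /subsetP AV /subsetP BV AB; apply/setP => x; apply/idP/idP => xA.
  have : f x \in f @: B by rewrite -AB imset_f.
  case/imsetP => y yB /finj ->//; [exact: AV|exact: BV].
have : f x \in f @: A by rewrite AB imset_f.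
case/imsetP => y yB /finj ->//; [exact: BV|exact: AV].
Qed.

Lemma iso_component (A : {set 'I_(gsize g)}) v : A \subset vertices g ->
  v \in A -> component (f @: A) (f v) = f @: component A v.
Proof.
move=> /subsetP AV vA; apply: component_transport => //.
- by move=> x y /AV ? /AV ?; exact: finj.
- by move=> x y /AV ? /AV ?; exact: fE.
Qed.

Lemma iso_mem (A : {set 'I_(gsize g)}) v : A \subset vertices g ->
  v \in vertices g -> (f v \in f @: A) = (v \in A).
Proof.
move=> /subsetP AV vV; apply/imsetP/idP => [[w wA /finj ->]//|vA]; first exact: AV.
by exists v.
Qed.

Lemma iso_ordered (s : {set 'I_(gsize g)}) : s \subset vertices g ->
  ordered_subtree (f @: s) && (f @: s != set0) =
  ordered_subtree s && (s != set0).
Proof.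
move=> sV; rewrite !ordered_subtreeE// -froot iso_mem// -{1}fV imsetS// sV /=.
case: (boolP (root g \in s)) => //= rs; rewrite iso_component//.
apply/eqP/eqP => [/iso_imset_inj ->//|->//].
exact: (subset_trans (component_sub _ _)).
Qed.

Lemma iso_setD (s : {set 'I_(gsize g)}) : s \subset vertices g ->
  vertices h :\: f @: s = f @: (vertices g :\: s).
Proof.
move=> sV; apply/setP => y; apply/setDP/imsetP => [[]|[x /setDP[xV xs] ->]].
  rewrite -{1}fV => /imsetP[x xV ->]; rewrite iso_mem// => xs.
  by exists x => //; apply/setDP.
by rewrite -{1}fV imset_f// iso_mem.
Qed.

Lemma iso_cut_roots (s : {set 'I_(gsize g)}) : s \subset vertices g ->
  cut_roots (f @: s) = f @: cut_roots s.
Proof.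
move=> sV; apply/setP => y; rewrite inE iso_setD//.
apply/andP/imsetP => [[/imsetP[x xD ->]]|[x]].
  move=> H; exists x => //; rewrite inE xD /=.
  have xV : x \in vertices g by case/setDP: xD.
  case/orP: H => [/eqP|/existsP[w /andP[/imsetP[z zs ->]]]].
    by rewrite -froot => /finj ->//; rewrite eqxx.
  have zV := subsetP sV _ zs.
  by rewrite fE// => zx; apply/orP; right; apply/existsP; exists z; rewrite zs.
rewrite inE => /andP[xD H] ->; split; first exact: imset_f.
have xV : x \in vertices g by case/setDP: xD.
case/orP: H => [/eqP ->|/existsP[w /andP[ws wx]]]; first by rewrite froot eqxx.
apply/orP; right; apply/existsP; exists (f w).
by rewrite imset_f// fE// (subsetP sV).
Qed.

Lemma iso_induced (A : {set 'I_(gsize g)}) v : A \subset vertices g ->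
  iso_graph (induced A v) (induced (f @: A) (f v)).
Proof.
move=> /subsetP AV; apply: induced_iso.
- by move=> x y /AV ? /AV ?; exact: finj.
- by move=> x y /AV ? /AV ?; exact: fE.
Qed.

Lemma iso_forest_prod (A : comNzRingType) (a : rtree0 -> A)
    (s : {set 'I_(gsize g)}) : s \subset vertices g ->
  forest_prod a (f @: s) = forest_prod a s.
Proof.
move=> sV; rewrite /forest_prod iso_cut_roots// big_imset /=; last first.
  by move=> x y /cut_rootsP/setDP[? _] /cut_rootsP/setDP[? _]; exact: finj.
apply: eq_bigr => v /cut_rootsP vD; congr a.
rewrite iso_setD// iso_component ?subsetDl//.
apply/esym/tree_class_iso; first exact: component_tree.
  rewrite -iso_component ?subsetDl// component_tree//.
  exact: imset_f.
apply: iso_induced.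
apply: subset_trans (subsetDl (vertices g) s); exact: component_sub.
Qed.

Lemma graph_sum_iso_fun (A : comNzRingType) (a : rtree0 -> A) (F : rtree -> A) :
  graph_sum a F g = graph_sum a F h.
Proof.
rewrite /graph_sum.
(* [f] is injective only on vertices, while the index type contains all sets of ordinals;
   intersecting with [vertices g] makes image and preimage mutually inverse. *)
rewrite [RHS](reindex_onto (fun s => f @: (s :&: vertices g))
   (fun s => f @^-1: s :&: vertices g)); last first.
  move=> s /andP[/and3P[sV _ _] _]; apply/setP => y; apply/imsetP/idP.
    by case=> x; rewrite !inE => /andP[/andP[fx _] _] ->.
  move=> ys; have := subsetP sV _ ys; rewrite -fV => /imsetP[x xV yE].
  by exists x => //; rewrite !inE xV -yE ys.
apply: eq_big => s.
  case: (boolP (s \subset vertices g)) => sV; last first.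
    rewrite {1}/ordered_subtree (negbTE sV) /=; apply/esym/negbTE.
    rewrite negb_and; apply/orP; right; apply: contraNN sV => /eqP <-.
    exact: subsetIr.
  have sI : s :&: vertices g = s by apply/setIidPl.
  rewrite sI iso_ordered//.
  suff -> : f @^-1: (f @: s) :&: vertices g = s by rewrite eqxx andbT.
  apply/setP => x; rewrite !inE; case: (boolP (x \in vertices g)) => xV.
    by rewrite andbT iso_mem.
  by rewrite andbF; apply/esym/negbTE; apply: contraNN xV; exact: (subsetP sV).
move=> os; have /andP[/and3P[sV _ _] s0] := os.
have sI : s :&: vertices g = s by apply/setIidPl.
rewrite sI iso_forest_prod// -froot; congr (oapp _ _ _ * _).
apply: tree_class_iso.
- by case/andP: os => *; apply: ordered_tree.
- rewrite froot; move: os; rewrite -iso_ordered// => /andP[*].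
  by apply: ordered_tree.
- exact: iso_induced.
Qed.

End GraphIso.

Lemma graph_sum_iso (A : comNzRingType) (a : rtree0 -> A) (F : rtree -> A)
    (g h : gtree) : iso_graph g h -> graph_sum a F g = graph_sum a F h.
Proof. by case=> f [fV finj fr fE]; exact: (graph_sum_iso_fun fV finj fr fE). Qed.

(** * The Butcher product *)

Arguments butcher_graph : simpl never.

Lemma component_trans (g : rgraph) (A : {set 'I_(gsize g)}) v w :
  w \in component A v -> component A w \subset component A v.
Proof.
rewrite inE => /andP[_ vw]; apply/subsetP => x; rewrite !inE => /andP[-> wx].
exact: connect_trans vw wx.
Qed.

Definition jset m n (A : {set 'I_m}) (B : {set 'I_n}) : {set 'I_(m + n)} :=
  [set lshift n x | x in A] :|: [set rshift m y | y in B].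

Lemma jset_l m n (A : {set 'I_m}) (B : {set 'I_n}) x :
  (lshift n x \in jset A B) = (x \in A).
Proof.
rewrite in_setU (mem_imset _ _ (@lshift_inj _ _)); case: (x \in A) => //=.
by apply/negbTE/imsetP => -[y _ /eqP]; rewrite eq_lrshift.
Qed.

Lemma jset_r m n (A : {set 'I_m}) (B : {set 'I_n}) y :
  (rshift m y \in jset A B) = (y \in B).
Proof.
rewrite in_setU (mem_imset _ _ (@rshift_inj _ _)) orbC; case: (y \in B) => //=.
by apply/negbTE/imsetP => -[x _ /eqP]; rewrite eq_rlshift.
Qed.

Lemma jset_inj m n (A A' : {set 'I_m}) (B B' : {set 'I_n}) :
  (jset A B == jset A' B') = (A == A') && (B == B').
Proof.
apply/eqP/andP => [AB|[/eqP -> /eqP ->]]//; split; apply/eqP/setP => x.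
  by rewrite -(jset_l A B) AB jset_l.
by rewrite -(jset_r A B) AB jset_r.
Qed.

Lemma jset_set0 m n (A : {set 'I_m}) :
  jset A (set0 : {set 'I_n}) = [set lshift n x | x in A].
Proof. by rewrite /jset imset0 setU0. Qed.

Lemma jsetP m n (C : {set 'I_(m + n)}) :
  C = jset (@lshift m n @^-1: C) (@rshift m n @^-1: C).
Proof.
by apply/setP => x; case: (split_ordP x) => i ->; rewrite ?jset_l ?jset_r inE.
Qed.

Lemma jset_setD m n (A A' : {set 'I_m}) (B B' : {set 'I_n}) :
  jset A B :\: jset A' B' = jset (A :\: A') (B :\: B').
Proof.
apply/setP => x; case: (split_ordP x) => i ->.
  by rewrite in_setD !jset_l in_setD.
by rewrite in_setD !jset_r in_setD.
Qed.

Lemma jset_sub m n (A A' : {set 'I_m}) (B B' : {set 'I_n}) :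
  (jset A B \subset jset A' B') = (A \subset A') && (B \subset B').
Proof. by rewrite -!setD_eq0 jset_setD -(jset_inj _ set0 _ set0) /jset !imset0 setU0. Qed.

Lemma sum_jset (V : nmodType) m n (P : pred {set 'I_(m + n)}) F :
  \sum_(s | P s) F s =
  \sum_(p : {set 'I_m} * {set 'I_n} | P (jset p.1 p.2)) F (jset p.1 p.2) :> V.
Proof.
rewrite (reindex (fun p : {set 'I_m} * {set 'I_n} => jset p.1 p.2))//.
exists (fun s : {set 'I_(m + n)} => (@lshift m n @^-1: s, @rshift m n @^-1: s)) => [[A B] _|s _] /=.
  by congr pair; apply/setP => x; rewrite inE ?jset_l ?jset_r.
by rewrite -jsetP.
Qed.

Section Butcher.
Variables g h : gtree.
Local Notation G := (butcher_graph g h).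
Local Notation l := (@lshift (gsize g) (gsize h)).
Local Notation r := (@rshift (gsize g) (gsize h)).

Lemma split_l (x : 'I_(gsize g)) : fintype.split (l x) = inl x.
Proof. exact: (unsplitK (inl x)). Qed.

Lemma split_r (x : 'I_(gsize h)) : fintype.split (r x) = inr x.
Proof. exact: (unsplitK (inr x)). Qed.

Lemma butcher_ll x y : @edge G (l x) (l y) = edge x y.
Proof. by rewrite /edge /= !split_l. Qed.
Lemma butcher_rr x y : @edge G (r x) (r y) = edge x y.
Proof. by rewrite /edge /= !split_r. Qed.
Lemma butcher_lr x y : @edge G (l x) (r y) = (x == root g) && (y == root h).
Proof. by rewrite /edge /= split_l split_r. Qed.
Lemma butcher_rl x y : @edge G (r y) (l x) = (x == root g) && (y == root h).
Proof. by rewrite /edge /= split_l split_r. Qed.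
Definition butcher_edgeE := (butcher_ll, butcher_rr, butcher_lr, butcher_rl).

Lemma butcher_sym : symmetric (@edge G).
Proof.
move=> x y; case: (split_ordP x) => i ->; case: (split_ordP y) => j ->;
by rewrite !butcher_edgeE// edge_gtree_sym.
Qed.

Let gs := @edge_gtree_sym g.
Let hs := @edge_gtree_sym h.

(** The two sides are linked by a single edge between the roots, so that the part in [h] is all or
    nothing, according to whether [root h] is available. *)
Lemma butcher_component (s1 : {set 'I_(gsize g)}) (s2 : {set 'I_(gsize h)}) :
  root g \in s1 ->
  @component G (jset s1 s2) (root G) =
  jset (component s1 (root g))
       (if root h \in s2 then component s2 (root h) else set0).
Proof.
move=> rs1; set C2 := if _ then _ else _; apply/eqP; rewrite eqEsubset.
have lC : l @: component s1 (root g) \subset @component G (jset s1 s2) (root G).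
  apply: (@component_map g G) => //.
    by apply/subsetP => _ /imsetP[x xs ->]; rewrite jset_l.
  by move=> x y _ _; rewrite butcher_ll.
apply/andP; split.
  apply: component_least; first exact: butcher_sym.
    by rewrite jset_l component_root.
  move=> x y; case: (split_ordP x) => i ->; case: (split_ordP y) => j ->;
    rewrite butcher_edgeE !(jset_l, jset_r).
  - exact: component_edge.
  - rewrite /C2 => _ js /andP[_ /eqP je]; rewrite -je js component_root//.
  - by move=> _ js /andP[/eqP -> _]; rewrite component_root.
  - by rewrite /C2; case: ifP => _; [exact: component_edge|rewrite inE].
rewrite /jset subUset lC /= /C2; case: ifP => rs2; last by rewrite imset0 sub0set.
apply: (@subset_trans _ _ (mem (@component G (jset s1 s2) (r (root h))))).
  apply: (@component_map h G) => //.
    by apply/subsetP => _ /imsetP[x xs ->]; rewrite jset_r.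
  by move=> x y _ _; rewrite butcher_rr.
apply: component_trans; apply: (@component_edge _ _ _ (root G)).
- by apply: component_root; rewrite jset_l.
- by rewrite jset_r.
- by rewrite butcher_lr !eqxx.
Qed.

(** Once [s1] contains [root g], the linking edge is cut and the two sides no longer interact. *)
Lemma butcher_component_l (s1 : {set 'I_(gsize g)}) (s2 : {set 'I_(gsize h)}) v :
  root g \in s1 -> v \in vertices g :\: s1 ->
  @component G (vertices G :\: jset s1 s2) (l v) =
  l @: component (vertices g :\: s1) v.
Proof.
move=> rs vD; apply: (@component_transport g G) => //.
- exact: butcher_sym.
- by move=> x y _ _; exact: lshift_inj.
- by apply/subsetP => _ /imsetP[x xs ->]; rewrite jset_setD jset_l.
- by move=> x y _ _; rewrite butcher_ll.
move=> x y xD; rewrite jset_setD; case: (split_ordP y) => j ->.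
  by rewrite jset_l => jD _; exact: imset_f.
by rewrite butcher_lr => _ /andP[/eqP xr _]; move: xD; rewrite xr inE rs.
Qed.

Lemma butcher_component_r (s1 : {set 'I_(gsize g)}) (s2 : {set 'I_(gsize h)}) v :
  root g \in s1 -> v \in vertices h :\: s2 ->
  @component G (vertices G :\: jset s1 s2) (r v) =
  r @: component (vertices h :\: s2) v.
Proof.
move=> rs vD; apply: (@component_transport h G) => //.
- exact: butcher_sym.
- by move=> x y _ _; exact: rshift_inj.
- by apply/subsetP => _ /imsetP[x xs ->]; rewrite jset_setD jset_r.
- by move=> x y _ _; rewrite butcher_rr.
move=> x y xD; rewrite jset_setD; case: (split_ordP y) => j ->.
  by rewrite jset_l butcher_rl inE => /andP[jn _] /andP[/eqP jr _]; rewrite jr rs in jn.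
by rewrite jset_r => jD _; exact: imset_f.
Qed.

(** Every edge between the two sides has [root G] as an endpoint. *)
Lemma butcher_path_side x p : path (@edge G) x p -> root G \notin x :: p ->
  all (fun y : 'I_(gsize g + gsize h) => (y < gsize g)%N == (x < gsize g)%N) p.
Proof.
elim: p x => //= y p IH x /andP[xy yp]; rewrite !inE !negb_or.
move=> /and3P[rx ry rp].
have e : (y < gsize g)%N == (x < gsize g)%N.
  move: xy rx ry; case: (split_ordP x) => i ->; case: (split_ordP y) => j -> //;
    by case/andP => /eqP ->; rewrite eqxx.
rewrite e /=; apply/allP => z zp; rewrite (eqP (allP (IH _ yp _) z zp)) ?(eqP e)//.
by rewrite inE negb_or ry.
Qed.

Lemma butcher_acyclic (p : seq 'I_(gsize G)) :
  ucycle (@edge G) p -> (size p < 3)%N.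
Proof.
have left_cycle q : all (fun y : 'I_(gsize g + gsize h) => y < gsize g)%N q ->
    ucycle (@edge G) q -> (size q < 3)%N.
  move=> ql; have -> : q = map l (map (fun y =>
      if fintype.split y is inl i then i else root g) q).
    elim: q ql => //= y q IH /andP[yl ql]; rewrite -IH//; congr cons.
    by move: yl; case: (split_ordP y) => j -> //=; rewrite ltnNge leq_addr.
  rewrite /ucycle cycle_map (map_inj_uniq (@lshift_inj _ _)) size_map.
  rewrite (eq_cycle (e' := @edge g)); first exact: acyclic_gtree.
  by move=> x y; exact: butcher_ll.
have right_cycle q : all (fun y : 'I_(gsize g + gsize h) => ~~ (y < gsize g))%N q ->
    ucycle (@edge G) q -> (size q < 3)%N.
  move=> ql; have -> : q = map r (map (fun y =>
      if fintype.split y is inr i then i else root h) q).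
    elim: q ql => //= y q IH /andP[yl ql]; rewrite -IH//; congr cons.
    by move: yl; case: (split_ordP y) => j -> //=; rewrite ltn_ord.
  rewrite /ucycle cycle_map (map_inj_uniq (@rshift_inj _ _)) size_map.
  rewrite (eq_cycle (e' := @edge h)); first exact: acyclic_gtree.
  by move=> x y; exact: butcher_rr.
(* A cycle through the root, rotated to start there, either stays on the left, or enters and leaves
   the right side through [root h]; the latter repeats a vertex unless the cycle has size 2. *)
case: (boolP (root G \in p)) => [rp|].
  case: (rot_to rp) => i q pE; rewrite -(size_rot i) -(rot_ucycle i) pE.
  case: q {pE} => // x q pc; have /andP[/=] := pc.
  rewrite rcons_path => /and3P[rx xq qr] /andP[rn xuq].
  have /(_ rn) := butcher_path_side xq.
  case: (boolP (x < gsize g)%N) => xl xqs.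
    apply: left_cycle pc; rewrite /= ltn_ord xl /=.
    by apply: sub_all xqs => y /= /eqP ->.
  have side z : z \in x :: q -> ~~ (z < gsize g)%N.
    rewrite inE => /orP[/eqP ->//|zq].
    by have /= /eqP -> := allP xqs _ zq.
  have xr : x = r (root h).
    move: rx xl; case: (split_ordP x) => j -> //.
    by rewrite split_l => /andP[_ /eqP ->].
  have lr : last x q = r (root h).
    move: qr (side _ (mem_last x q)); case: (split_ordP (last x q)) => j -> //.
    by rewrite split_l => /andP[_ /eqP ->].
  case: q {pc rn xq qr xqs side} xuq lr => // y q /= /andP[xn _] lr.
  by move: xn; rewrite xr -lr mem_last.
case: p => // x p rn pc; have /andP[/=] := pc; rewrite rcons_path => /andP[xp _] _.
have xqs := butcher_path_side xp rn.
case: (boolP (x < gsize g)%N) => xl; [apply: left_cycle pc|apply: right_cycle pc];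
  rewrite /= ?xl /=; apply: sub_all xqs => y /= /eqP ->//.
Qed.

Lemma is_tree_butcher : is_tree G.
Proof.
apply/and4P; split.
- by rewrite jset_l root_vertex.
- apply/'forall_forallP => x y; apply/implyP.
  rewrite -[vertices G]/(jset (vertices g) (vertices h)) (butcher_sym y x) => xy.
  rewrite xy andbT.
  move: xy; case: (split_ordP x) => i ->; case: (split_ordP y) => j ->;
    rewrite butcher_edgeE !(jset_l, jset_r).
  + by move=> /edge_gtree[-> -> ij _]; rewrite eq_lshift.
  + by move=> /andP[/eqP -> /eqP ->]; rewrite !root_vertex eq_lrshift.
  + by move=> /andP[/eqP -> /eqP ->]; rewrite !root_vertex eq_rlshift.
  + by move=> /edge_gtree[-> -> ij _]; rewrite eq_rshift.
- rewrite (connected_inE (v := root G)); last by rewrite jset_l root_vertex.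
    rewrite butcher_component ?root_vertex//.
    by rewrite !component_connected ?root_vertex ?connected_gtree.
  exact: butcher_sym.
- by apply/asboolP => p; exact: butcher_acyclic.
Qed.

Definition gbutcher : gtree := GTree is_tree_butcher.

Lemma butcher_ordered (s1 : {set 'I_(gsize g)}) (s2 : {set 'I_(gsize h)}) :
  @ordered_subtree G (jset s1 s2) && (jset s1 s2 != set0) =
  (ordered_subtree s1 && (s1 != set0)) && ordered_subtree s2.
Proof.
rewrite (@ordered_subtreeE G); last exact: butcher_sym.
rewrite (ordered_subtreeE _ gs) jset_sub jset_l.
case: (boolP (root g \in s1)) => rs1; last by rewrite !andbF.
rewrite butcher_component// jset_inj /=.
rewrite -!andbA; congr andb; rewrite andbCA; congr andb.
case: (eqVneq s2 set0) => [->|s20].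
  by rewrite inE eqxx sub0set ordered_subtree0.
have := ordered_subtreeE s2 hs; rewrite s20 andbT => ->; congr andb.
case: ifP => _ //=; apply/negbTE; move: s20; apply: contra => /eqP <-//.
Qed.

(** If [root h] is outside [s2], the linking edge makes it a cut root of the product; in [h] alone
    the clause of [cut_roots] about the root does the same. *)
Lemma butcher_cut_roots (s1 : {set 'I_(gsize g)}) (s2 : {set 'I_(gsize h)}) :
  root g \in s1 ->
  @cut_roots G (jset s1 s2) = jset (cut_roots s1) (cut_roots s2).
Proof.
move=> rs1; apply/setP => x.
rewrite inE -[vertices G]/(jset (vertices g) (vertices h)) jset_setD.
case: (split_ordP x) => i ->.
  rewrite !jset_l [RHS]inE eq_lshift; case: (boolP (i \in _ :\: _)) => iD; rewrite ?andFb// !andTb.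
  congr orb; apply/existsP/existsP => -[w /andP[]].
    case: (split_ordP w) => j ->; rewrite ?jset_l ?jset_r butcher_edgeE => js.
      by move=> ji; exists j; rewrite js.
    by move=> /andP[/eqP ir _]; move: iD; rewrite ir inE rs1.
  by move=> ws wi; exists (l w); rewrite jset_l butcher_ll ws.
rewrite !jset_r [RHS]inE eq_rlshift orFb; case: (boolP (i \in _ :\: _)) => iD; rewrite ?andFb// !andTb.
apply/existsP/orP => [[w /andP[]]|[/eqP ->|/existsP[w /andP[ws wi]]]].
- case: (split_ordP w) => j ->; rewrite ?jset_l ?jset_r butcher_edgeE => js.
    by move=> /andP[_ ->]; left.
  by move=> ji; right; apply/existsP; exists j; rewrite js.
- by exists (l (root g)); rewrite jset_l rs1 butcher_lr !eqxx.
- by exists (r w); rewrite jset_r butcher_rr ws.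
Qed.

Lemma induced_l (A : {set 'I_(gsize g)}) v :
  iso_graph (induced A v) (@induced G (l @: A) (l v)).
Proof.
apply: (@induced_iso g G l).
- by move=> x y _ _; exact: lshift_inj.
- by move=> x y _ _; exact: butcher_ll.
Qed.

Lemma induced_r (A : {set 'I_(gsize h)}) v :
  iso_graph (induced A v) (@induced G (r @: A) (r v)).
Proof.
apply: (@induced_iso h G r).
- by move=> x y _ _; exact: rshift_inj.
- by move=> x y _ _; exact: butcher_rr.
Qed.

Lemma butcher_forest_prod (A : comNzRingType) (a : rtree0 -> A)
    (s1 : {set 'I_(gsize g)}) (s2 : {set 'I_(gsize h)}) : root g \in s1 ->
  @forest_prod A a G (jset s1 s2) = forest_prod a s1 * forest_prod a s2.
Proof.
move=> rs1; rewrite /forest_prod big_split_ord /=; congr (_ * _).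
  apply: eq_big => v; first by rewrite butcher_cut_roots// jset_l.
  rewrite butcher_cut_roots// jset_l => /cut_rootsP vD; congr a.
  rewrite butcher_component_l//; apply/esym/tree_class_iso.
  - exact: component_tree.
  - rewrite -(butcher_component_l s2 rs1 vD) (@component_tree gbutcher)//.
    by rewrite jset_setD jset_l.
  - exact: induced_l.
apply: eq_big => v; first by rewrite butcher_cut_roots// jset_r.
rewrite butcher_cut_roots// jset_r => /cut_rootsP vD; congr a.
rewrite butcher_component_r//; apply/esym/tree_class_iso.
- exact: component_tree.
- rewrite -(butcher_component_r rs1 vD) (@component_tree gbutcher)//.
  by rewrite jset_setD jset_r.
- exact: induced_r.
Qed.

End Butcher.

(** Applied to isomorphic factors ([iso_butcher]), to the splitting of a tree along an edge at its
    root ([gtree_decompose]) and to subtrees of a product ([graph_sum_butcher]). *)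
Lemma iso_jset (g h k : rgraph) (f : 'I_(gsize g) -> 'I_(gsize k))
    (f' : 'I_(gsize h) -> 'I_(gsize k)) :
  vertices k = f @: vertices g :|: f' @: vertices h ->
  {in vertices g &, injective f} -> {in vertices h &, injective f'} ->
  {in vertices g & vertices h, forall x y, f x != f' y} ->
  f (root g) = root k ->
  {in vertices g &, forall x y, edge (f x) (f y) = edge x y} ->
  {in vertices h &, forall x y, edge (f' x) (f' y) = edge x y} ->
  {in vertices g & vertices h, forall x y,
     (edge (f x) (f' y) = (x == root g) && (y == root h)) /\
     (edge (f' y) (f x) = (x == root g) && (y == root h))} ->
  iso_graph (butcher_graph g h) k.
Proof.
move=> kV finj f'inj ff' fr fE f'E ffE.
pose F (z : 'I_(gsize g + gsize h)) :=
  match fintype.split z with inl x => f x | inr y => f' y end.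
have Fl x : F (lshift (gsize h) x) = f x by rewrite /F (unsplitK (inl x)).
have Fr y : F (rshift (gsize g) y) = f' y by rewrite /F (unsplitK (inr y)).
exists F; split.
- rewrite kV -[vertices (butcher_graph g h)]/(jset (vertices g) (vertices h)).
  by rewrite /jset imsetU -2!imset_comp; congr (_ :|: _); apply: eq_imset => x /=.
- move=> x y; rewrite -[vertices (butcher_graph g h)]/(jset (vertices g) (vertices h)).
  case: (split_ordP x) => i ->; case: (split_ordP y) => j ->;
    rewrite !(jset_l, jset_r) !(Fl, Fr).
  + by move=> iV jV /finj ->.
  + by move=> iV jV /eqP; rewrite (negbTE (ff' _ _ iV jV)).
  + by move=> iV jV /esym/eqP; rewrite (negbTE (ff' _ _ jV iV)).
  + by move=> iV jV /f'inj ->.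
- by rewrite -fr -Fl.
- move=> x y; rewrite -[vertices (butcher_graph g h)]/(jset (vertices g) (vertices h)).
  rewrite [edge x y]/edge /=.
  case: (split_ordP x) => i ->; case: (split_ordP y) => j ->;
    rewrite !(jset_l, jset_r) !(Fl, Fr) => iV jV.
  + exact: fE.
  + by case: (ffE _ _ iV jV).
  + by case: (ffE _ _ jV iV).
  + exact: f'E.
Qed.

Lemma iso_butcher (g h : rgraph) (g' h' : gtree) :
  root g \in vertices g -> root h \in vertices h ->
  iso_graph g g' -> iso_graph h h' ->
  iso_graph (butcher_graph g h) (butcher_graph g' h').
Proof.
move=> rg rh [f [fV finj fr fE]] [k [kV kinj kr kE]].
apply: (@iso_jset g h (butcher_graph g' h')
  (lshift (gsize h') \o f) (@rshift (gsize g') (gsize h') \o k)).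
- rewrite -[LHS]/(jset (vertices g') (vertices h')) /jset -fV -kV.
  by rewrite (imset_comp (lshift _) f) (imset_comp (@rshift _ _) k).
- by move=> x y xV yV /lshift_inj/finj ->.
- by move=> x y xV yV /rshift_inj/kinj ->.
- by move=> x y _ _ /=; rewrite eq_lrshift.
- by rewrite /= fr.
- by move=> x y xV yV; rewrite butcher_ll fE.
- by move=> x y xV yV; rewrite butcher_rr kE.
- move=> x y xV yV; rewrite butcher_lr butcher_rl -fr -kr.
  have -> : (f x == f (root g)) = (x == root g).
    by apply/eqP/eqP => [/finj ->|->].
  have -> // : (k y == k (root h)) = (y == root h).
  by apply/eqP/eqP => [/kinj ->|->].
Qed.

Definition bt (u v : rtree) : rtree := \pi_rtree (gbutcher (repr u) (repr v)).

Lemma butcherE (u v : rtree) : butcher u v = Some (bt u v).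
Proof. exact: (tree_class_gtree (gbutcher (repr u) (repr v))). Qed.

Lemma bt_pi (g h : gtree) : bt (\pi_rtree g) (\pi_rtree h) = \pi_rtree (gbutcher g h).
Proof.
by apply: pi_iso; apply: iso_butcher; rewrite ?root_vertex//; exact: iso_repr.
Qed.

Lemma tsize_bt (u v : rtree) :
  tsize (Some (bt u v)) = (tsize (Some u) + tsize (Some v))%N.
Proof.
rewrite /bt tsize_pi -[vertices _]/(jset (vertices (repr u)) (vertices (repr v))).
rewrite cardsU (card_imset _ (@lshift_inj _ _)) (card_imset _ (@rshift_inj _ _)).
suff -> : [set lshift (gsize (repr v)) x | x in vertices (repr u)] :&:
          [set @rshift (gsize (repr u)) _ y | y in vertices (repr v)] = set0.
  by rewrite cards0 subn0.
apply/setP => x; rewrite inE [RHS]inE; apply/negbTE/andP => -[/imsetP[y _ ->]].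
by move=> /imsetP[z _ /eqP]; rewrite eq_lrshift.
Qed.

Lemma path_edge_in (g : rgraph) (A : {set 'I_(gsize g)}) x p :
  path (edge_in A) x p -> {subset p <= A}.
Proof.
move=> xp; apply/allP; elim: p x xp => //= y p IH x /andP[/and3P[_ _ ->]].
exact: IH.
Qed.

(** Cut an edge from the root to a neighbour [c]: [w] is the component of [c] after removal of the
    root, and [u] is the rest. *)
Lemma gtree_decompose (g : gtree) : (1 < #|vertices g|)%N ->
  exists u w : gtree, iso_graph (gbutcher u w) g.
Proof.
move=> V1; have rV := root_vertex g; have gs := @edge_gtree_sym g.
have [c rc] : exists c, edge (root g) c.
  have [x xV xr] : exists2 x, x \in vertices g & x != root g.
    apply/exists_inP; apply: contraLR V1; rewrite negb_exists_in -leqNgt.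
    move=> /forall_inP H; rewrite -(cards1 (root g)); apply: subset_leq_card.
    by apply/subsetP => x /H; rewrite negbK inE.
  have : x \in component (vertices g) (root g).
    by rewrite component_connected ?connected_gtree.
  rewrite inE => /andP[_ /connectP[[|c p] /=]] => [_ xE|/andP[/and3P[rc _ _] _] _].
    by rewrite xE eqxx in xr.
  by exists c.
have [_ cV nrc _] := edge_gtree rc.
pose W := component (vertices g :\ root g) c.
have cD : c \in vertices g :\ root g by rewrite !inE cV eq_sym nrc.
have WD : W \subset vertices g :\ root g by exact: component_sub.
have WV : W \subset vertices g by apply: subset_trans WD (subsetDl _ _).
pose U := vertices g :\: W.
have rU : root g \in U.
  rewrite inE rV andbT; apply/negP => /(subsetP WD); by rewrite !inE eqxx.
(* [W] is a component of the tree minus its root, so it can only be left through the root. *)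
have out x y : x \in W -> y \in vertices g -> y \notin W -> edge x y -> y = root g.
  move=> xW yV yW xy; apply/eqP; apply: contraNT yW => yr.
  by apply: (component_edge xW) => //; rewrite !inE yr.
have cU : connected_in U.
  rewrite (connected_inE gs rU) eqEsubset component_sub /=.
  suff : vertices g \subset component U (root g) :|: W.
    move=> /subsetP sV; apply/subsetP => x; rewrite inE => /andP[xW xV].
    by have := sV _ xV; rewrite in_setU (negbTE xW) orbF.
  rewrite -{1}(component_connected (connected_gtree g) rV).
  apply: component_least => //; first by rewrite inE component_root.
  move=> x y xCW yV xy; rewrite in_setU orbC; case: (boolP (y \in W)) => //= yW.
  move: xCW; rewrite in_setU => /orP[xC|xW].
    by apply: (component_edge xC) => //; rewrite inE yW.
  by rewrite (out _ _ xW yV yW xy) component_root.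
pose u := GTree (is_tree_induced rU cU).
pose w := GTree (component_tree cD).
(* A second edge from the root into [W], ending at [y], would close a cycle with the path from [c]
   to [y]; [shortenP] makes this path simple. *)
have rW y : y \in W -> edge (root g) y -> y = c.
  move=> yW ry; apply/eqP; apply: contraT => yc.
  have := yW; rewrite inE => /andP[_ /connectP[p pp yE]].
  move: yE; case/shortenP: pp => q qp qu _ yE.
  suff : ucycle (@edge g) [:: root g, c & q].
    move/acyclic_gtree; case: q yE {qp qu} => //= yE; by rewrite yE eqxx in yc.
  apply/andP; split.
    rewrite /= rc rcons_path -yE gs ry andbT.
    by apply: sub_path qp => a b /and3P[].
  rewrite cons_uniq qu andbT; apply/negP => rq.
  have : root g \in vertices g :\ root g.
    move: rq; by rewrite inE (negbTE nrc) => /(path_edge_in qp).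
  by rewrite !inE eqxx.
exists u, w; apply: (@iso_jset u w g id id) => //.
- by rewrite !imset_id /= setUC -{1}(setID (vertices g) W) (setIidPr WV).
- by move=> x y /= xU yW; apply: contraTneq xU => ->; rewrite inE yW.
- by move=> x y xU yU /=; rewrite /edge_in xU yU !andbT.
- by move=> x y xU yU /=; rewrite /edge_in xU yU !andbT.
- move=> x y xU yW /=; suff E : @edge g x y = (x == root g) && (y == c).
    by split; [exact: E|rewrite gs; exact: E].
  apply/idP/andP => [|[/eqP -> /eqP ->]//]; rewrite gs => yx.
  move: xU; rewrite inE => /andP[xW xV].
  have xr := out _ _ yW xV xW yx.
  by rewrite xr eqxx (rW y) -?xr// gs.
Qed.

(** Strong induction on the number of vertices: by [tsize_bt] both factors of a decomposition are
    smaller, because neither is empty. *)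
Lemma rtree_ind (Q : rtree -> Prop) :
  (forall t, tsize (Some t) = 1%N -> Q t) ->
  (forall u v, Q u -> Q v -> Q (bt u v)) -> forall t, Q t.
Proof.
move=> Q1 Qbt t; have [n] := ubnP (tsize (Some t)); elim: n t => // n IH t tn.
have := tsize_gt0 t; rewrite leq_eqVlt => /orP[/eqP /esym /Q1 //|t1].
have [u [w uw]] := gtree_decompose t1.
have tE : t = bt (\pi_rtree u) (\pi_rtree w).
  by rewrite bt_pi -[LHS]reprK; apply/esym/pi_iso.
have := tsize_gt0 (\pi_rtree u); have := tsize_gt0 (\pi_rtree w).
move: tn; rewrite tE tsize_bt => tn w0 u0.
have lt2 (p q m : nat) : (p + q < m.+1 -> 0 < p -> 0 < q -> p < m /\ q < m)%N.
  rewrite ltnS => pqm p0 q0; split; apply: leq_trans pqm.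
    by rewrite -addn1 leq_add2l.
  by rewrite -add1n leq_add2r.
by have [ltu ltw] := lt2 _ _ _ tn u0 w0; apply: Qbt; exact: IH.
Qed.

(** * Recursion for the sums over the ordered subtrees of a Butcher product *)

Lemma forest_prod0 (A : comNzRingType) (a : rtree0 -> A) (g : gtree) :
  forest_prod a (set0 : {set 'I_(gsize g)}) = a (Some (\pi_rtree g)).
Proof.
have rV := root_vertex g.
rewrite /forest_prod (_ : cut_roots _ = [set root g]).
  rewrite big_set1 setD0 component_connected ?connected_gtree//.
  rewrite -tree_class_gtree; congr a; apply: tree_class_iso.
  - by apply: is_tree_induced => //; exact: connected_gtree.
  - by case: (g).
  - exists id; split => //; first by rewrite imset_id.
    by move=> x y xV yV /=; rewrite /edge_in xV yV !andbT.
apply/setP => x; rewrite !inE /=.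
rewrite (_ : [exists w in set0, edge w x] = false) ?orbF.
  by case: eqP => [->|]; rewrite ?rV ?andbF.
by apply/negbTE/existsP => -[w]; rewrite inE.
Qed.

Lemma forest_prodT (A : comNzRingType) (a : rtree0 -> A) (g : gtree) :
  forest_prod a (vertices g) = 1.
Proof.
by rewrite /forest_prod big1// => v; rewrite inE setDv inE.
Qed.

Lemma tree_class_set0 (g : rgraph) : tree_class (@induced g set0 (root g)) = None.
Proof. by rewrite /tree_class insubF// /is_tree /= inE. Qed.

(** A non-empty ordered subtree of the product is a pair of a non-empty [s1] and an arbitrary [s2].
    For empty [s2] all of [h] is cut off, which gives the factor [a h]; otherwise the subtree is
    itself a Butcher product. *)
Lemma graph_sum_butcher (A : comNzRingType) (a : rtree0 -> A) (f : rtree -> A)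
    (g h : gtree) :
  graph_sum a f (gbutcher g h) =
  graph_sum a (fun s => a (Some (\pi_rtree h)) * f s +
                        graph_sum a (fun r => f (bt s r)) h) g.
Proof.
rewrite /graph_sum [LHS]sum_jset.
transitivity (\sum_(s1 : {set 'I_(gsize g)} | ordered_subtree s1 && (s1 != set0))
  \sum_(s2 : {set 'I_(gsize h)} | ordered_subtree s2)
    oapp f 0 (tree_class (@induced (butcher_graph g h) (jset s1 s2)
                            (root (butcher_graph g h)))) *
    @forest_prod A a (butcher_graph g h) (jset s1 s2)).
  by rewrite pair_big; apply: eq_bigl => p; rewrite -butcher_ordered.
apply: eq_bigr => s1 os1.
have /andP[os1' s10] := os1.
have rs1 : root g \in s1 by case/and3P: os1' => _ _; rewrite s10.
have T1 := ordered_tree os1' s10.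
rewrite (tree_classE T1) (bigD1 set0) ?ordered_subtree0//=.
rewrite butcher_forest_prod// forest_prod0 jset_set0 mulrDl; congr (_ + _).
  rewrite (_ : tree_class _ = Some (\pi_rtree (GTree T1))).
    by rewrite /= mulrA mulrAC [_ * a _]mulrC.
  rewrite -(tree_classE T1); apply/esym/tree_class_iso => //; last exact: induced_l.
  rewrite -jset_set0; apply: (@ordered_tree (gbutcher g h)).
    by have := butcher_ordered (h := h) s1 set0; rewrite os1 ordered_subtree0 => /andP[].
  by have := butcher_ordered (h := h) s1 set0; rewrite os1 ordered_subtree0 => /andP[].
rewrite mulr_suml; apply: eq_bigr => s2 /andP[os2 s20].
have T2 := ordered_tree os2 s20.
rewrite (tree_classE T2) butcher_forest_prod//= -mulrA [forest_prod a s1 * _]mulrC.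
congr (_ * _); rewrite bt_pi -[f _]/(oapp f 0 (Some _)) -tree_class_gtree.
congr (oapp f 0 _); apply: tree_class_iso.
- have := butcher_ordered s1 s2; rewrite os1 os2 => /andP[*].
  exact: (@ordered_tree (gbutcher g h)).
- exact: is_tree_butcher.
have rs2 : root h \in s2 by case/and3P: os2 => _ _; rewrite s20.
apply: iso_graph_sym; first by rewrite jset_l.
apply: (@iso_jset (induced s1 (root g)) (induced s2 (root h))
  (@induced (butcher_graph g h) (jset s1 s2) (root (butcher_graph g h)))
  (lshift (gsize h)) (@rshift (gsize g) (gsize h))) => //.
- by move=> x y _ _; exact: lshift_inj.
- by move=> x y _ _; exact: rshift_inj.
- by move=> x y _ _; rewrite eq_lrshift.
- by move=> x y xs ys; rewrite /= /edge_in !jset_l butcher_ll.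
- by move=> x y xs ys; rewrite /= /edge_in !jset_r butcher_rr.
- move=> x y xs ys; rewrite /= /edge_in !jset_r !jset_l butcher_lr butcher_rl.
  by rewrite xs ys !andbT.
Qed.

(* The part of the sum in the product of a and f that runs over the non-empty
   ordered subtrees, as a linear operator in f. *)
Definition tsum (A : comNzRingType) (a : rtree0 -> A) (f : rtree -> A)
    (t : rtree) : A := graph_sum a f (repr t).

Section TreeSum.
Variable A : comNzRingType.
Implicit Types (a b : rtree0 -> A) (f : rtree -> A).

Lemma tsum_bt a f u v :
  tsum a f (bt u v) =
  tsum a (fun s => a (Some v) * f s + tsum a (fun r => f (bt s r)) v) u.
Proof.
rewrite /tsum (graph_sum_iso _ _ (iso_repr _)) graph_sum_butcher /graph_sum.
by rewrite reprK.
Qed.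

Lemma tsumZD a c f f' t :
  tsum a (fun s => c * f s + f' s) t = c * tsum a f t + tsum a f' t.
Proof.
rewrite /tsum /graph_sum mulr_sumr -big_split; apply: eq_bigr => s _ /=.
by case: (tree_class _) => [x|] /=; rewrite ?mul0r ?mulr0 ?addr0// mulrDl mulrA.
Qed.

Lemma tsum_exchange a b (f : rtree -> rtree -> A) t u :
  tsum a (fun s => tsum b (f s) u) t = tsum b (fun r => tsum a (f^~ r) t) u.
Proof.
rewrite /tsum /graph_sum.
transitivity (\sum_(s : {set 'I_(gsize (repr t))} | ordered_subtree s && (s != set0))
  \sum_(r : {set 'I_(gsize (repr u))} | ordered_subtree r && (r != set0))
   oapp (fun x => oapp (f x) 0 (tree_class (induced r (root (repr u))))) 0
     (tree_class (induced s (root (repr t)))) * forest_prod b r * forest_prod a s).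
  apply: eq_bigr => s _; case: (tree_class _) => [x|] /=; first by rewrite mulr_suml.
  by rewrite mul0r big1// => r _; rewrite !mul0r.
rewrite exchange_big; apply: eq_bigr => r _ /=.
case: (tree_class (induced r _)) => [y|] /=.
  rewrite mulr_suml; apply: eq_bigr => s _; rewrite -!mulrA; congr (_ * _).
  by rewrite mulrC.
by rewrite mul0r big1// => s _; case: (tree_class _) => [x|] /=; rewrite !mul0r.
Qed.

(** The full vertex set contributes [f t] with an empty forest. Every other non-empty subtree is
    smaller than [t], and so are the trees that it cuts off, as they miss its vertices. *)
Lemma tsum_local a a' f f' t :
  (forall s, (tsize s < tsize (Some t))%N -> a s = a' s) ->
  (forall s, (tsize (Some s) < tsize (Some t))%N -> f s = f' s) ->
  tsum a f t - f t = tsum a' f' t - f' t.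
Proof.
move=> aE fE; set g := repr t.
have oV : ordered_subtree (vertices g) && (vertices g != set0).
  have rV := root_vertex g.
  rewrite /ordered_subtree subxx connected_gtree rV implybT /=.
  by apply/set0Pn; exists (root g).
have cV : tree_class (induced (vertices g) (root g)) = Some t.
  rewrite -[t]reprK -(tree_class_gtree (repr t)); apply: tree_class_iso.
  - by apply: is_tree_induced; [exact: root_vertex|exact: connected_gtree].
  - by case: (repr t).
  - exists id; split => //; first by rewrite imset_id.
    by move=> x y xV yV /=; rewrite /edge_in xV yV !andbT.
rewrite /tsum /graph_sum !(bigD1 (vertices g) oV) /= cV /= !forest_prodT !mulr1.
rewrite addrAC subrr add0r addrAC subrr add0r.
apply: eq_bigr => s /andP[/andP[/and3P[sV _ _] s0] snV]; congr (_ * _).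
  case E: (tree_class _) => [x|//] /=; apply: fE.
  have := tsize_class (induced s (root g)); rewrite E => /leq_ltn_trans; apply.
  by apply: proper_card; rewrite properEneq snV.
apply: eq_bigr => v /cut_rootsP vD; apply: aE.
apply: leq_ltn_trans (tsize_class _) _.
apply: (@leq_ltn_trans #|vertices g :\: s|).
  by rewrite /= subset_leq_card// component_sub.
apply: proper_card; rewrite properE subsetDl; apply/subsetPn.
case/set0Pn: s0 => x xs; exists x; first exact: (subsetP sV).
by rewrite inE xs.
Qed.

Lemma tsum_top a f t :
  (forall s, (tsize (Some s) < tsize (Some t))%N -> f s = 0) -> tsum a f t = f t.
Proof.
move=> f0; apply/eqP; rewrite -subr_eq0; apply/eqP.
rewrite (@tsum_local a a f (fun=> 0) t)// subr0 /tsum /graph_sum big1// => s _.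
by case: (tree_class _) => [x|] /=; rewrite mul0r.
Qed.

Lemma tsum_leaf a f t : tsize (Some t) = 1%N -> tsum a f t = f t.
Proof.
by move=> t1; apply: tsum_top => s; rewrite t1 ltnS leqNgt tsize_gt0.
Qed.

Lemma tm_mulE a b t :
  tm_mul a b (Some t) = b None * a (Some t) + tsum a (b \o Some) t.
Proof.
rewrite /= (bigD1 set0) ?ordered_subtree0//= tree_class_set0.
rewrite -/(forest_prod a set0) forest_prod0 reprK; congr (_ + _).
apply: eq_bigr => s /andP[os s0]; congr (_ * _).
by rewrite (tree_classE (ordered_tree os s0)).
Qed.

End TreeSum.

(** * The Butcher group and its exponential map *)

Section ButcherAlgebra.
Variable A : comNzRingType.
Implicit Types (a b c : rtree0 -> A) (f : rtree -> A).

(** Associativity in operator form. The induction is for all [f] at once, since [tsum_bt] replaces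
    [f] by other functions; [b None = 1] makes the empty subtree contribute exactly [a (Some w)] to
    the product at [w]. *)
Lemma tsum_mul a b f t : b None = 1 ->
  tsum (tm_mul a b) f t = tsum a (tsum b f) t.
Proof.
move=> b1; elim/rtree_ind: t f => [t t1 f|u w IHu IHw f]; first by rewrite !tsum_leaf.
rewrite !tsum_bt IHu; congr (tsum _ _ _); apply/funext => s.
rewrite tsumZD (_ : (fun r => tsum b f (bt s r)) = (fun r => tsum b f s * b (Some r) +
    tsum b (fun s' => tsum b (fun r' => f (bt s' r')) r) s)); last first.
  by apply/funext => r; rewrite tsum_bt tsumZD mulrC.
rewrite tsumZD tm_mulE b1 mul1r mulrDl -addrA; congr (_ + (_ + _)).
  by rewrite mulrC.
(* After the exchange the sum over [w] stands inside, where the induction hypothesis applies to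
   [r |-> f (bt s' r)]. *)
rewrite [RHS]tsum_exchange; congr (tsum _ _ _); apply/funext => s'.
exact: IHw.
Qed.

Lemma tm_mulA a b c : b None = 1 ->
  tm_mul a (tm_mul b c) = tm_mul (tm_mul a b) c.
Proof.
move=> b1; apply/funext => -[t|//]; rewrite !tm_mulE b1 tsum_mul// [tm_mul b c None]/=.
rewrite (_ : tm_mul b c \o Some = (fun s => c None * b (Some s) +
  tsum b (c \o Some) s)); last by apply/funext => s; rewrite /= -tm_mulE.
by rewrite tsumZD mul1r mulrDr addrA.
Qed.

Lemma tsum_one f t : tsum (@tm_one A) f t = f t.
Proof.
elim/rtree_ind: t f => [t t1 f|u w IHu IHw f]; first by rewrite tsum_leaf.
by rewrite tsum_bt IHu IHw mul0r add0r.
Qed.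

Lemma tm_mul1 b : tm_mul (@tm_one A) b = b.
Proof.
by apply/funext => -[t|//]; rewrite tm_mulE tsum_one /= mulr0 add0r.
Qed.

Lemma tm_mulr1 a : a None = 1 -> tm_mul a (@tm_one A) = a.
Proof.
move=> a1; apply/funext => -[t|]; last by rewrite a1.
rewrite tm_mulE mul1r tsum_top ?addr0//.
Qed.

(** Strict triangularity with respect to the number of vertices, which allows [x + N x = y] to be
    solved tree by tree. *)
Definition tri (N : (rtree0 -> A) -> rtree0 -> A) :=
  forall x x' t, (forall s, (tsize s < tsize t)%N -> x s = x' s) -> N x t = N x' t.

(** After n rounds the iteration has settled on all trees with fewer than n vertices, whence the
    count [(tsize t).+1]. Being finite, it stays polynomial when [N] is. *)
Definition tri_solve (N : (rtree0 -> A) -> rtree0 -> A) (y : rtree0 -> A) t :=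
  iter (tsize t).+1 (fun x s => y s - N x s) (fun=> 0) t.

Lemma tri_solveE N y t : tri N -> tri_solve N y t = y t - N (tri_solve N y) t.
Proof.
move=> triN; have stab n m s : (tsize s < n)%N -> (tsize s < m)%N ->
    iter n (fun x s => y s - N x s) (fun=> 0) s =
    iter m (fun x s => y s - N x s) (fun=> 0) s.
  elim: n m s => // n IH [//|m] s sn sm /=; congr (_ - _); apply: triN => s' s's.
  by apply: IH; exact: leq_trans s's _.
rewrite {1}/tri_solve iterS; congr (_ - _); apply: triN => s st.
exact: stab.
Qed.

Lemma tri_unique N x x' : tri N ->
  (forall t, x t + N x t = x' t + N x' t) -> x = x'.
Proof.
move=> triN xx'; apply/funext => t.
have [n] := ubnP (tsize t); elim: n t => // n IH t tn.
have := xx' t; rewrite (triN x x' t) => [/addIr//|s st].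
by apply: IH; apply: leq_trans st _.
Qed.

Definition mul_rest a b t := tm_mul a b t - b t.

Lemma tri_mul_rest a : tri (mul_rest a).
Proof.
move=> x x' [t|] xx'; last by rewrite /mul_rest /= !subrr.
rewrite /mul_rest !tm_mulE (xx' None) ?tsize_gt0// -!addrA; congr (_ + _).
by apply: (tsum_local (f := x \o Some) (f' := x' \o Some)) => // s /xx'.
Qed.

Definition tm_inv a := tri_solve (mul_rest a) (@tm_one A).

Lemma tm_mulV a : tm_mul a (tm_inv a) = @tm_one A.
Proof.
apply/funext => t; have := tri_solveE (@tm_one A) t (@tri_mul_rest a).
by rewrite -/(tm_inv a) /mul_rest => /eqP; rewrite opprB addrCA -subr_eq0 opprD
  addrA subrr add0r oppr_eq0 subr_eq0 => /eqP ->.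
Qed.

Lemma tm_inv_None a : tm_inv a None = 1.
Proof. by have := congr1 (@^~ None) (tm_mulV a). Qed.

(** The usual monoid argument: [b = tm_inv a] has the right inverse [tm_inv b], and [a = a (b
    (tm_inv b)) = (a b) (tm_inv b) = tm_inv b]. *)
Lemma tm_mulVl a : a None = 1 -> tm_mul (tm_inv a) a = @tm_one A.
Proof.
move=> a1; set b := tm_inv a; have b1 : b None = 1 by exact: tm_inv_None.
suff -> : a = tm_inv b by exact: tm_mulV.
rewrite -[LHS]tm_mulr1// -(tm_mulV b) tm_mulA//.
by rewrite tm_mulV tm_mul1.
Qed.

Definition phi a u v : A :=
  a (Some (bt u v)) + a (Some (bt v u)) - a (Some u) * a (Some v).

Lemma phi_one u v : phi (@tm_one A) u v = 0.
Proof. by rewrite /phi /tm_one /= mul0r subr0 addr0. Qed.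

(** By [tsum_bt] each of the two grafted trees yields a mixed term, [a w] times the sum over [u] or
    [a u] times the sum over [w]; these cancel against the mixed terms in the product of the values
    at [u] and [w]. *)
Lemma phi_mul a b u w : b None = 1 ->
  phi (tm_mul a b) u w =
  phi a u w + tsum a (fun s => tsum a (fun r => phi b s r) w) u.
Proof.
move=> b1; pose Q := tsum a (fun s => tsum a (fun r => b (Some (bt s r))) w) u.
pose Q' := tsum a (fun s => tsum a (fun r => b (Some (bt r s))) w) u.
have -> : tsum a (fun s => tsum a (fun r => phi b s r) w) u =
    Q + Q' - tsum a (b \o Some) w * tsum a (b \o Some) u.
  rewrite (_ : (fun s => _) = (fun s => (- tsum a (b \o Some) w) * (b \o Some) s +
    (1 * tsum a (fun r => b (Some (bt s r))) w + tsum a (fun r => b (Some (bt r s))) w))).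
    by rewrite !tsumZD mul1r -/Q -/Q' addrC mulNr.
  apply/funext => s /=; rewrite (_ : (fun r => phi b s r) =
    (fun r => (- b (Some s)) * (b \o Some) r + (1 * b (Some (bt s r)) + b (Some (bt r s))))).
    by rewrite !tsumZD !mul1r; ring.
  by apply/funext => r; rewrite /phi /=; ring.
rewrite /phi !tm_mulE b1 !tsum_bt !(tsumZD a _ (b \o Some)) -/Q.
rewrite (_ : tsum a (fun s => tsum a (fun r => (b \o Some) (bt s r)) u) w = Q').
  by ring.
by rewrite tsum_exchange.
Qed.

Lemma tsum2_top a (f : rtree -> rtree -> A) u w :
  (forall s r, (tsize (Some s) + tsize (Some r) < tsize (Some u) + tsize (Some w))%N ->
     f s r = 0) ->
  tsum a (fun s => tsum a (f s) w) u = f u w.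
Proof.
move=> f0; rewrite tsum_top => [|s su]; rewrite tsum_top//.
- by move=> r rw; apply: f0; rewrite ltn_add2l.
- by apply: f0; rewrite ltn_add2r.
- by move=> r rw; apply: f0; rewrite -addnS leq_add// ltnW.
Qed.

Definition symplectic a := a None = 1 /\ forall u w, phi a u w = 0.

Lemma symplectic_one : symplectic (@tm_one A).
Proof. by split => // u w; exact: phi_one. Qed.

Lemma symplectic_mul a b : symplectic a -> symplectic b -> symplectic (tm_mul a b).
Proof.
move=> [a1 a0] [b1 b0]; split => // u w; rewrite phi_mul// a0 add0r.
by rewrite tsum2_top.
Qed.

(** Apply [phi_mul] to [a (tm_inv a) = e]: if [phi (tm_inv a)] vanishes on all smaller pairs, the
    double sum reduces to its top term, which must then vanish. *)
Lemma symplectic_inv a : symplectic a -> symplectic (tm_inv a).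
Proof.
move=> [a1 a0]; split; first exact: tm_inv_None.
move=> u w; have [n] := ubnP (tsize (Some u) + tsize (Some w)).
elim: n u w => // n IH u w uwn.
have := phi_mul a u w (tm_inv_None a).
rewrite tm_mulV phi_one a0 add0r tsum2_top// => s r sr.
by apply: IH; apply: leq_trans sr _.
Qed.

End ButcherAlgebra.

(** * The derivative of the product at the identity *)

Section Derivation.
Variable A : comNzRingType.
Implicit Types (a b c v : rtree0 -> A) (f : rtree -> A).

(* The derivative of forest_prod at tm_one, in direction v. *)
Definition dforest (v : rtree0 -> A) (g : rgraph) (s : {set 'I_(gsize g)}) : A :=
  let c x := tree_class (induced (component (vertices g :\: s) x) x) in
  \sum_(x in cut_roots s) v (c x) * \prod_(y in cut_roots s | y != x) tm_one A (c y).

(** The tangent map of right translation by [b], applied to [v] (see [dderiv_mul]): the right-hand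
    side of the evolution equation. *)
Definition Der (v b : rtree0 -> A) (t : rtree0) : A :=
  if t is Some t then
    \sum_(s : {set 'I_(gsize (repr t))} | ordered_subtree s)
      b (tree_class (induced s (root (repr t)))) * dforest v s
  else 0.

(** Full polynomials stand in for dual numbers: only the coefficients 0 and 1 are read. *)
Definition eps (v : rtree0 -> A) (t : rtree0) : {poly A} := (tm_one A t)%:P + v t *: 'X.

Lemma coef1M (p q : {poly A}) : (p * q)`_1 = p`_0 * q`_1 + p`_1 * q`_0.
Proof. by rewrite coefM big_ord_recr big_ord1. Qed.

Lemma coef1_prod (I : finType) (S : {set I}) (x v : I -> A) :
  (\prod_(i in S) ((x i)%:P + v i *: 'X))`_1 =
  \sum_(i in S) v i * \prod_(j in S | j != i) x j.
Proof.
have e1 i : ((x i)%:P + v i *: 'X)`_1 = v i.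
  by rewrite coefD coefC coefZ coefX /= mulr1 add0r.
have e0 i : ((x i)%:P + v i *: 'X)`_0 = x i.
  by rewrite coefD coefC coefZ coefX /= mulr0 addr0.
rewrite -!big_enum (eq_bigr (fun i => v i * \prod_(j <- enum S | j != i) x j)); last first.
  by move=> i _; rewrite big_enum_cond.
elim: (enum S) (enum_uniq S) => [_|a s IH /= /andP[as_ us]].
  by rewrite !big_nil coef1.
rewrite !big_cons eqxx /= coef1M e0 e1 IH// coef0_prod [RHS]addrC.
congr (_ + _ * _).
  rewrite mulr_sumr big_seq [RHS]big_seq; apply: eq_bigr => i is_.
  have ai : a != i by apply: contraNneq as_ => ->.
  by rewrite big_cons ai mulrCA.
rewrite [RHS]big_seq_cond [LHS]big_seq; apply: eq_big => [j|j _]; last exact: e0.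
by case: (boolP (j \in s)) => //= js; apply/esym; apply: contraNneq as_ => <-.
Qed.

Lemma DerE v b t : Der v b t = (tm_mul (eps v) (fun s => (b s)%:P) t)`_1.
Proof.
case: t => [t|]; last by rewrite coefC.
rewrite /= coef_sum; apply: eq_bigr => s _; rewrite coefCM; congr (_ * _).
exact/esym/coef1_prod.
Qed.

Lemma tm_mul_coef0 v b t : (tm_mul (eps v) (fun s => (b s)%:P) t)`_0 = b t.
Proof.
case: t => [t|]; last by rewrite coefC.
rewrite -[in RHS](tm_mul1 b) /= coef_sum; apply: eq_bigr => s _.
rewrite coefCM coef0_prod; congr (_ * _); apply: eq_bigr => x _.
by rewrite coefD coefC coefZ coefX /= mulr0 addr0.
Qed.

Lemma Der_some v b t :
  Der v b (Some t) = b None * v (Some t) +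
    (tsum (eps v) (fun s => (b (Some s))%:P) t)`_1.
Proof.
rewrite DerE tm_mulE coefD coefCM; congr (_ * _ + _).
by rewrite coefD coefC coefZ coefX /= mulr1 add0r.
Qed.

(** The tree [t] itself could enter twice. The empty subtree gives [b None * v t], which is
    subtracted; the full subtree gives [b t] with an empty forest, which has no first-order term. *)
Lemma Der_local v v' b b' t :
  (forall s, (tsize s < tsize (Some t))%N -> v s = v' s) ->
  (forall s, (tsize s < tsize (Some t))%N -> b s = b' s) ->
  Der v b (Some t) - b None * v (Some t) = Der v' b' (Some t) - b' None * v' (Some t).
Proof.
move=> vE bE; rewrite !Der_some addrAC subrr add0r addrAC subrr add0r.
have : tsum (eps v) (fun s => (b (Some s))%:P) t - (b (Some t))%:P =
       tsum (eps v') (fun s => (b' (Some s))%:P) t - (b' (Some t))%:P.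
  apply: (@tsum_local _ (eps v) (eps v') (fun s => (b (Some s))%:P)
     (fun s => (b' (Some s))%:P)) => s st; first by rewrite /eps vE.
  by rewrite bE.
by move=> /(congr1 (fun p : {poly A} => p`_1)); rewrite !coefB !coefC /= !subr0.
Qed.

(** The differential of [phi] at the identity: [e] vanishes on non-empty trees, so the product term
    is of second order. *)
Definition psi v u w : A := v (Some (bt u w)) + v (Some (bt w u)).

(** Read off the coefficient of [X] in [phi_mul] for [eps v]. Under the hypothesis on smaller pairs
    the double sum is the constant [phi b u w], which has no such coefficient, and [phi (eps v)]
    contributes [psi v]. *)
Lemma phi_Der v b u w : b None = 1 ->
  (forall s r, (tsize (Some s) + tsize (Some r) < tsize (Some u) + tsize (Some w))%N ->
     phi b s r = 0) ->
  Der v b (Some (bt u w)) + Der v b (Some (bt w u)) -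
    (Der v b (Some u) * b (Some w) + b (Some u) * Der v b (Some w)) = psi v u w.
Proof.
move=> b1 b0; pose B s := (b s)%:P : {poly A}.
have phiB s r : phi B s r = (phi b s r)%:P.
  by rewrite /phi rmorphB rmorphD rmorphM.
have epsE t : eps v (Some t) = v (Some t) *: 'X by rewrite /eps add0r.
have : (phi (tm_mul (eps v) B) u w)`_1 = psi v u w.
  rewrite phi_mul /B ?b1// coefD tsum2_top => [|s r sr]; last by rewrite phiB b0.
  rewrite phiB coefC addr0 /phi !epsE coefB coefD !coefZ !coefX !mulr1.
  by rewrite coef1M !coefZ !coefX !mulr0 mul0r addr0 subr0.
by rewrite /phi coefB coefD coef1M -!DerE !tm_mul_coef0 => <-; ring.
Qed.

End Derivation.

(** Naturality in the ring, here and in the next lemmas: [polyC] and [horner_eval] carry identities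
    between scalars and polynomial curves. *)
Lemma dforest_morph (A B : comNzRingType) (f : {rmorphism A -> B}) v (g : rgraph)
    (s : {set 'I_(gsize g)}) : dforest (f \o v) s = f (dforest v s).
Proof.
rewrite /dforest rmorph_sum; apply: eq_bigr => x _; rewrite rmorphM rmorph_prod.
by congr (_ * _); apply: eq_bigr => y _; rewrite /tm_one rmorph_nat.
Qed.

Lemma Der_morph (A B : comNzRingType) (f : {rmorphism A -> B}) v b t :
  Der (f \o v) (f \o b) t = f (Der v b t).
Proof.
case: t => [t|]; last by rewrite rmorph0.
by rewrite rmorph_sum; apply: eq_bigr => s _; rewrite dforest_morph rmorphM.
Qed.

Lemma phi_morph (A B : comNzRingType) (f : {rmorphism A -> B}) a u w :
  phi (f \o a) u w = f (phi a u w).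
Proof. by rewrite /phi rmorphB rmorphD rmorphM. Qed.

Lemma tm_mul_morph (A B : comNzRingType) (f : {rmorphism A -> B}) a b t :
  tm_mul (f \o a) (f \o b) t = f (tm_mul a b t).
Proof.
case: t => [t|//]; rewrite rmorph_sum; apply: eq_bigr => s _.
by rewrite rmorphM rmorph_prod.
Qed.

(** * The exponential map as a polynomial flow, and its inverse *)

Section Exponential.
Variable K : numFieldType.
Implicit Types (v b : rtree0 -> K).

(* The coefficients of the solution of eta' = Der v eta with eta 0 = tm_one. *)
Fixpoint exp_coef v (k : nat) : rtree0 -> K :=
  if k is k.+1 then fun t => k.+1%:R^-1 * Der v (exp_coef v k) t else tm_one K.

Lemma exp_coefS v k t : exp_coef v k.+1 t = k.+1%:R^-1 * Der v (exp_coef v k) t.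
Proof. by []. Qed.

Lemma exp_coef_None v k : exp_coef v k None = (k == 0)%:R.
Proof. by case: k => //= k; rewrite mulr0. Qed.

Lemma Der0 v t : Der v (fun=> 0) t = 0.
Proof. by case: t => //= t; rewrite big1// => s _; rewrite mul0r. Qed.

(** By [Der_local] the coefficient of order [k.+1] at [t] comes from those of order [k] at smaller
    trees, up to a multiple of [exp_coef v k None], which is zero for positive [k]. Thus each order
    uses up a vertex. *)
Lemma exp_coef_small v k t : (tsize t < k)%N -> exp_coef v k t = 0.
Proof.
elim: k t => // k IH [t|] tk; last by rewrite exp_coef_None.
rewrite exp_coefS (_ : Der v _ _ = 0) ?mulr0//.
have k0 : (0 < k)%N by apply: leq_trans (tsize_gt0 t) _.
have := @Der_local _ v v (exp_coef v k) (fun=> 0) t (fun _ _ => erefl).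
rewrite Der0 exp_coef_None (gtn_eqF k0) !mul0r !subr0; apply => s st.
by apply: IH; exact: leq_trans st _.
Qed.

(** In the step from order [k] to [k.+1], the value [v t] enters only through the empty subtree,
    with the factor [exp_coef v k None], which is non-zero only for [k = 0]. *)
Lemma exp_coef_local v v' k t :
  (forall s, (tsize s < tsize (Some t))%N -> v s = v' s) ->
  exp_coef v k (Some t) - (k == 1)%:R * v (Some t) =
  exp_coef v' k (Some t) - (k == 1)%:R * v' (Some t).
Proof.
elim: k t => [t _|k IH t vE]; first by rewrite !mul0r.
have {}IH : forall s, (tsize s < tsize (Some t))%N -> exp_coef v k s = exp_coef v' k s.
  move=> [s|] st; last by rewrite !exp_coef_None.
  have /IH : forall s', (tsize s' < tsize (Some s))%N -> v s' = v' s'.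
    by move=> s' s's; apply: vE; exact: ltn_trans st.
  by rewrite (vE (Some s) st) => /addIr.
have := Der_local vE IH; rewrite !exp_coef_None !exp_coefS.
rewrite (_ : k.+1 == 1 = (k == 0))// => /(congr1 ( *%R k.+1%:R^-1)).
rewrite !mulrBr; case: k {IH} => [|k]; first by rewrite invr1 !mul1r.
by rewrite !mul0r !mulr0.
Qed.

Definition flow v (t : rtree0) : {poly K} := \poly_(k < (tsize t).+1) exp_coef v k t.

Lemma coef_flow v t k : (flow v t)`_k = exp_coef v k t.
Proof. by rewrite coef_poly ltnS; case: leqP => // /exp_coef_small ->. Qed.

Lemma deriv_flow v t : (flow v t)^`() = Der (polyC \o v) (flow v) t.
Proof.
apply/polyP => k; rewrite coef_deriv coef_flow exp_coefS -mulrnAl -mulr_natr mulVf ?mul1r ?pnatr_eq0//.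
case: t => [t|]; last by rewrite coef0.
rewrite /= coef_sum; apply: eq_bigr => s _; rewrite (dforest_morph polyC) coefMC.
by rewrite coef_flow.
Qed.

Lemma flow_None v : flow v None = 1.
Proof. by apply/polyP => k; rewrite coef_flow exp_coef_None coef1. Qed.

Lemma flow0 v t : (flow v t).[0] = tm_one K t.
Proof. by rewrite horner_coef0 coef_flow. Qed.

(** Both sides agree at time 0 and have the same derivative: by induction [phi] vanishes along the
    flow on smaller pairs, so that [phi_Der] gives the constant [psi v u w]. *)
Lemma phi_flow v u w :
  (forall s r, (tsize (Some s) + tsize (Some r) < tsize (Some u) + tsize (Some w))%N ->
     psi v s r = 0) ->
  phi (flow v) u w = psi v u w *: 'X.
Proof.
have [n] := ubnP (tsize (Some u) + tsize (Some w)); elim: n u w => // n IH u w uwn v0.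
have phi0 s r : (tsize (Some s) + tsize (Some r) < tsize (Some u) + tsize (Some w))%N ->
    phi (flow v) s r = 0.
  move=> sr; rewrite IH ?v0 ?scale0r//; first exact: leq_trans sr _.
  by move=> s' r' sr'; apply: v0; exact: ltn_trans sr.
have /(congr1 (fun p : {poly K} => p)) := phi_Der (polyC \o v) (flow_None v) phi0.
rewrite -!deriv_flow -derivM -derivD -derivB -/(phi (flow v) u w) => dE.
have dE' : (phi (flow v) u w)^`() = (psi v u w)%:P by rewrite dE /psi rmorphD.
apply/polyP => -[|k].
  rewrite coefZ coefX mulr0 -horner_coef0 -[_.[0]]/(horner_eval 0 _) -phi_morph.
  transitivity (phi (tm_one K) u w); last exact: phi_one.
  by congr (phi _ u w); apply/funext => t; exact: flow0.
have := congr1 (fun p : {poly K} => p`_k) dE'; rewrite coef_deriv coefC coefZ coefX eqSS.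
move=> E; have k0 : k.+1%:R != 0 :> K by rewrite pnatr_eq0.
apply: (mulfI k0); rewrite mulr_natl E.
by case: k {E k0} => [|k]; rewrite ?mul1r ?mulr1// !mulr0.
Qed.

Definition tm_exp v (t : rtree0) : K := (flow v t).[1].

(** The Lie algebra of the symplectic tree maps, see [Lie_algebra_S]. *)
Definition hamiltonian v := v None = 0 /\ forall u w, psi v u w = 0.

Lemma exp_coef_scale (x : K) v k t :
  exp_coef (fun s => x * v s) k t = x ^+ k * exp_coef v k t.
Proof.
elim: k t => [|k IH] t; first by rewrite mul1r.
rewrite !exp_coefS mulrCA; congr (_ * _); case: t => [t|]; last by rewrite mulr0.
rewrite mulr_sumr; apply: eq_bigr => s _; rewrite IH exprS.
suff -> : dforest (fun s' => x * v s') s = x * dforest v s by ring.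
by rewrite /dforest mulr_sumr; apply: eq_bigr => i _; rewrite mulrA.
Qed.

(** Scaling [v] amounts to scaling time. The derivative of [tm_exp] at 0 is read off from this
    polynomial in [x]. *)
Lemma tm_exp_scale (x : K) v t : tm_exp (fun s => x * v s) t = (flow v t).[x].
Proof.
rewrite /tm_exp !horner_poly; apply: eq_bigr => k _.
by rewrite exp_coef_scale expr1n mulr1 mulrC.
Qed.

Lemma exp_coef1 v t : v None = 0 -> exp_coef v 1 t = v t.
Proof.
move=> v0; rewrite exp_coefS invr1 mul1r; case: t => [t|]; last by rewrite v0.
by rewrite Der_some mul1r tsum_top ?coefC ?addr0// => s _; rewrite polyC0.
Qed.

Lemma phi_horner (f : rtree0 -> {poly K}) (x : K) u w :
  phi (fun t => (f t).[x]) u w = (phi f u w).[x].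
Proof. exact: (phi_morph (horner_eval x)). Qed.

Lemma symplectic_flow v x : hamiltonian v -> symplectic (fun t => (flow v t).[x]).
Proof.
move=> [_ v0]; split; first by rewrite flow_None hornerC.
by move=> u w; rewrite phi_horner phi_flow// v0 scale0r horner0.
Qed.

(** Once [psi v] vanishes on all smaller pairs, [phi_flow] at time 1 equates [phi (tm_exp v)] with
    [psi v]. *)
Lemma symplectic_hamiltonian v : v None = 0 -> symplectic (tm_exp v) -> hamiltonian v.
Proof.
move=> vN [_ v0]; split=> // u w.
have [n] := ubnP (tsize (Some u) + tsize (Some w)); elim: n u w => // n IH u w uwn.
have := v0 u w; rewrite phi_horner phi_flow; first by rewrite hornerZ hornerX mulr1.
by move=> s r sr; apply: IH; exact: leq_trans sr _.
Qed.

(** At the empty tree the formula of the first branch would give [1 - v None], which is not strictly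
    triangular; hence the separate value 0. *)
Definition exp_rest v (t : rtree0) : K :=
  if t is Some _ then tm_exp v t - v t else 0.

Lemma tri_exp_rest : tri exp_rest.
Proof.
move=> v v' [t|//] vE; rewrite /exp_rest /tm_exp !horner_poly.
(* The linear term is written as a sum supported at [k = 1], so that [exp_coef_local] applies
   coefficient by coefficient. *)
have sumE x : x (Some t) =
    \sum_(k < (tsize (Some t)).+1) (k == 1 :> nat)%:R * x (Some t) :> K.
  have t1 : (1 < (tsize (Some t)).+1)%N by rewrite ltnS tsize_gt0.
  rewrite (bigD1 (Ordinal t1)) //= mul1r big1 ?addr0// => i.
  by rewrite -val_eqE /= => /negbTE ->; rewrite mul0r.
rewrite {1}(sumE v) {1}(sumE v') -!sumrB; apply: eq_bigr => k _.
by rewrite !expr1n !mulr1; exact: exp_coef_local.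
Qed.

Definition tm_log (a : rtree0 -> K) := tri_solve exp_rest (fun t => a t - tm_one K t).

Lemma tm_exp_None v : tm_exp v None = 1.
Proof. by rewrite /tm_exp flow_None hornerC. Qed.

Lemma tm_log_None a : a None = 1 -> tm_log a None = 0.
Proof. by move=> a1; rewrite /tm_log (tri_solveE _ _ tri_exp_rest) a1 /= subrr subr0. Qed.

Lemma tm_logK a : a None = 1 -> tm_exp (tm_log a) = a.
Proof.
move=> a1; apply/funext => -[t|]; last by rewrite tm_exp_None.
have := tri_solveE (fun t => a t - tm_one K t) (Some t) tri_exp_rest.
by rewrite -/(tm_log a) /= subr0 => /eqP; rewrite opprB addrCA -subr_eq0 opprD addrA
  subrr add0r oppr_eq0 subr_eq0 => /eqP ->.
Qed.

Lemma tm_expK v : v None = 0 -> tm_log (tm_exp v) = v.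
Proof.
move=> v0; apply: (tri_unique tri_exp_rest) => t.
rewrite {1}/tm_log (tri_solveE _ _ tri_exp_rest) subrK.
case: t => [t|]; last by rewrite tm_exp_None /= subrr v0 addr0.
by rewrite /= subr0 addrC subrK.
Qed.

Lemma symplectic_tm_exp v : hamiltonian v -> symplectic (tm_exp v).
Proof. exact: symplectic_flow. Qed.

Lemma hamiltonian_tm_log a : symplectic a -> hamiltonian (tm_log a).
Proof.
move=> sa; have [a1 _] := sa; apply: symplectic_hamiltonian; first exact: tm_log_None.
by rewrite tm_logK.
Qed.

End Exponential.

(** * The topology of pointwise convergence *)

From mathcomp Require Import all_classical all_reals all_analysis.
Import numFieldNormedType.Exports.
Import ArrowAsProduct.

Local Open Scope classical_set_scope.
Local Open Scope ring_scope.

Lemma cvg_coord (T I : Type) (V : topologicalType) (F : set_system T)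
    (f : T -> I -> V) (l : I -> V) : Filter F ->
  (forall i, (fun x => f x i) @ F --> l i) -> f @ F --> l.
Proof.
move=> FF fl; apply/cvg_sup => i U [_ [[W oW <-]] Wl WU].
apply: (filterS WU); apply: fl; exact: open_nbhs_nbhs.
Qed.

Lemma pointwise_continuous (I : Type) (V : topologicalType) (i : I) :
  continuous (fun x : I -> V => x i).
Proof.
move=> x; have /cvg_sup /(_ i) xi : nbhs x --> x by [].
apply: cvg_trans (@initial_continuous _ _ (fun x : I -> V => x i) x).
by apply: cvg_app.
Qed.

Lemma cvg_coordE (T I : Type) (V : topologicalType) (F : set_system T)
    (f : T -> I -> V) (l : I -> V) i : Filter F ->
  f @ F --> l -> (fun x => f x i) @ F --> l i.
Proof.
move=> FF fl.
exact: (@cvg_comp _ _ _ f (fun y => y i) F _ _ fl (@pointwise_continuous I V i l)).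
Qed.

Lemma coord_comp_continuous (T : topologicalType) (I : Type) (V : topologicalType)
    (f : T -> I -> V) i : continuous f -> continuous (fun t => f t i).
Proof. by move=> fc t; exact: (@cvg_coordE T I V (nbhs t) f (f t) i _ (fc t)). Qed.

(** Uniqueness of limits identifies the value chosen by [get] in [dderiv] (see [dderivE]). *)
Lemma pointwise_hausdorff (I : Type) (K : numFieldType) :
  hausdorff_space (I -> K).
Proof.
move=> x y xy; apply/funext => i; apply: (@norm_hausdorff K K^o).
move=> A B Ax By; have [] := xy ((fun z => z i) @^-1` A) ((fun z => z i) @^-1` B).
- exact: pointwise_continuous.
- exact: pointwise_continuous.
by move=> z [zA zB]; exists (z i).
Qed.

(** * Polynomial maps *)

(* Polynomials in finitely many of the variables V with rational coefficients,
   so that they can be evaluated in every numFieldType. *)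
Inductive pexp (V : Type) : Type :=
| PConst of rat
| PVar of V
| PAdd of pexp V & pexp V
| PMul of pexp V & pexp V.
Arguments PConst {V}.

Fixpoint peval (V : Type) (K : numFieldType) (e : pexp V) (x : V -> K) : K :=
  match e with
  | PConst q => ratr q
  | PVar v => x v
  | PAdd e1 e2 => peval e1 x + peval e2 x
  | PMul e1 e2 => peval e1 x * peval e2 x
  end.

Fixpoint psubst (V W : Type) (s : V -> pexp W) (e : pexp V) : pexp W :=
  match e with
  | PConst q => PConst q
  | PVar v => s v
  | PAdd e1 e2 => PAdd (psubst s e1) (psubst s e2)
  | PMul e1 e2 => PMul (psubst s e1) (psubst s e2)
  end.

Lemma peval_subst (V W : Type) (K : numFieldType) (s : V -> pexp W) e (x : W -> K) :
  peval (psubst s e) x = peval e (fun v => peval (s v) x).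
Proof. by elim: e => //= e1 -> e2 ->. Qed.

(* The derivative in a direction whose component at v is the value of the
   variable d v, or zero. *)
Fixpoint pderiv (V : Type) (d : V -> option V) (e : pexp V) : pexp V :=
  match e with
  | PConst _ => PConst 0
  | PVar v => if d v is Some w then PVar w else PConst 0
  | PAdd e1 e2 => PAdd (pderiv d e1) (pderiv d e2)
  | PMul e1 e2 => PAdd (PMul (pderiv d e1) e2) (PMul e1 (pderiv d e2))
  end.

(** The restriction of [e] to the line [x + X y]; its coefficient of degree 1 is the directional
    derivative. *)
Fixpoint pline (V : Type) (K : numFieldType) (e : pexp V) (x y : V -> K) : {poly K} :=
  match e with
  | PConst q => (ratr q)%:P
  | PVar v => (x v)%:P + y v *: 'X
  | PAdd e1 e2 => pline e1 x y + pline e2 x y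
  | PMul e1 e2 => pline e1 x y * pline e2 x y
  end.

Lemma horner_pline (V : Type) (K : numFieldType) (e : pexp V) (x y : V -> K) h :
  (pline e x y).[h] = peval e (fun v => x v + h * y v).
Proof.
elim: e => /= [q|v|e1 IH1 e2 IH2|e1 IH1 e2 IH2].
- by rewrite hornerC.
- by rewrite hornerD hornerC hornerZ hornerX mulrC.
- by rewrite hornerD IH1 IH2.
- by rewrite hornerM IH1 IH2.
Qed.

Lemma coef_pline (V : Type) (K : numFieldType) (d : V -> option V) (e : pexp V)
    (x y : V -> K) : (forall v, y v = if d v is Some w then x w else 0) ->
  (pline e x y)`_0 = peval e x /\ (pline e x y)`_1 = peval (pderiv d e) x.
Proof.
move=> yE; elim: e => /= [q|v|e1 [IH10 IH11] e2 [IH20 IH21]|e1 [IH10 IH11] e2 [IH20 IH21]].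
- by rewrite !coefC rmorph0.
- rewrite !coefD !coefC !coefZ !coefX /= mulr0 mulr1 addr0 add0r yE; split=> //.
  by case: (d v) => //=; rewrite rmorph0.
- by rewrite !coefD IH10 IH11 IH20 IH21.
- by rewrite coef0M coef1M IH10 IH11 IH20 IH21 addrC.
Qed.

Lemma horner_continuous (K : numFieldType) (q : {poly K}) :
  continuous (fun x : K => q.[x]).
Proof.
elim/poly_ind: q => [|q c IH] x.
  have -> : (fun y : K => (0 : {poly K}).[y]) = fun=> 0.
    by apply/funext => y; rewrite horner0.
  exact: cst_continuous.
have -> : (fun y : K => (q * 'X + c%:P).[y]) = fun y => q.[y] * y + c.
  by apply/funext => y; rewrite hornerMXaddC.
have cM : {for x, continuous (fun y : K => q.[y] * y)}.
  by apply: (@continuousM K K (fun y => q.[y]) id x (IH x)); exact: cvg_id.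
exact: (@continuousD K K K _ (fun=> c) x cM (@cst_continuous _ _ c x)).
Qed.

(** For non-zero [h] the quotient of [q * 'X + c] is [q.[h]], which is continuous. All derivatives
    computed explicitly below reduce to this limit. *)
Lemma poly_diff_quot (K : numFieldType) (q : {poly K}) :
  (fun h : K => h^-1 * (q.[h] - q.[0])) @ 0^' --> q`_1.
Proof.
elim/poly_ind: q => [|q c _].
  rewrite coef0.
  have -> : (fun h : K => h^-1 * ((0 : {poly K}).[h] - (0 : {poly K}).[0])) = fun=> 0.
    by apply/funext => h; rewrite !horner0 subrr mulr0.
  exact: cvg_cst.
have -> : (q * 'X + c%:P)`_1 = q.[0].
  by rewrite coefD coefMX coefC /= addr0 horner_coef0.
apply: (@cvg_trans _ ((fun h => q.[h]) @ 0^')).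
  apply: near_eq_cvg; near=> h.
  rewrite !hornerMXaddC mulr0 add0r addrK mulrCA mulVf ?mulr1//.
  near: h; exact: nbhs_dnbhs_neq.
apply: cvg_trans (@horner_continuous K q 0); apply: cvg_app.
exact: cvg_within.
Unshelve. all: by end_near. Qed.

(** One expression for all fields: this is what links a real map to its complex extension. *)
Definition polyfun (I : Type) (f : forall K : numFieldType, (I -> K) -> K) : Prop :=
  exists e : pexp I, forall K x, f K x = peval e x.

Definition polymap (I J : Type)
    (f : forall K : numFieldType, (I -> K) -> (J -> K)) : Prop :=
  forall j, polyfun (fun K x => f K x j).

Section Polyfun.
Variable I : Type.
Implicit Types f g : forall K : numFieldType, (I -> K) -> K.

Lemma polyfun_var i : polyfun (fun K (x : I -> K) => x i).
Proof. by exists (PVar i). Qed.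

Lemma polyfun_nat n : polyfun (fun K (x : I -> K) => n%:R).
Proof. by exists (PConst n%:R) => K x /=; rewrite ratr_nat. Qed.

Lemma polyfun_natV n : polyfun (fun K (x : I -> K) => n%:R^-1).
Proof.
exists (PConst n%:R^-1) => K x; rewrite -[RHS]/(ratr n%:R^-1) fmorphV.
by rewrite rmorph_nat.
Qed.

Lemma polyfunD f g : polyfun f -> polyfun g -> polyfun (fun K x => f K x + g K x).
Proof. by move=> [e fE] [e' gE]; exists (PAdd e e') => K x /=; rewrite fE gE. Qed.

Lemma polyfunM f g : polyfun f -> polyfun g -> polyfun (fun K x => f K x * g K x).
Proof. by move=> [e fE] [e' gE]; exists (PMul e e') => K x /=; rewrite fE gE. Qed.

Lemma polyfunB f g : polyfun f -> polyfun g -> polyfun (fun K x => f K x - g K x).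
Proof.
move=> [e fE] [e' gE]; exists (PAdd e (PMul (PConst (-1)) e')) => K x /=.
by rewrite fE gE rmorphN rmorph1 mulN1r.
Qed.

Lemma polyfun_sum (T : Type) (r : seq T) (P : pred T)
    (F : T -> forall K : numFieldType, (I -> K) -> K) :
  (forall i, polyfun (F i)) -> polyfun (fun K x => \sum_(i <- r | P i) F i K x).
Proof.
move=> pF; elim: r => [|i r [e rE]].
  by exists (PConst 0) => K x; rewrite big_nil /= rmorph0.
have [ei iE] := pF i; exists (if P i then PAdd ei e else e) => K x.
by rewrite big_cons rE iE; case: (P i).
Qed.

Lemma polyfun_prod (T : Type) (r : seq T) (P : pred T)
    (F : T -> forall K : numFieldType, (I -> K) -> K) :
  (forall i, polyfun (F i)) -> polyfun (fun K x => \prod_(i <- r | P i) F i K x).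
Proof.
move=> pF; elim: r => [|i r [e rE]].
  by exists (PConst 1) => K x; rewrite big_nil /= rmorph1.
have [ei iE] := pF i; exists (if P i then PMul ei e else e) => K x.
by rewrite big_cons rE iE; case: (P i).
Qed.

Lemma polymap_iter (J : Type)
    (Phi : forall K : numFieldType, (I -> K) -> (J -> K) -> (J -> K)) n :
  (forall g : forall K : numFieldType, (I -> K) -> (J -> K),
     polymap g -> polymap (fun K x => Phi K x (g K x))) ->
  polymap (fun K x => iter n (Phi K x) (fun=> 0)).
Proof.
move=> pPhi; elim: n => [j|n IH]; first exact: (polyfun_nat 0).
exact: (pPhi (fun K x => iter n (Phi K x) (fun=> 0))).
Qed.

Implicit Types a b : forall K : numFieldType, (I -> K) -> (rtree0 -> K).

Lemma polymap_mul a b : polymap a -> polymap b ->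
  polymap (fun K x => tm_mul (a K x) (b K x)).
Proof.
move=> pa pb.
case=> [t|]; last exact: pb.
apply: polyfun_sum => s; apply: polyfunM; first exact: pb.
by apply: polyfun_prod => v; exact: pa.
Qed.

Lemma polymap_Der a b : polymap a -> polymap b ->
  polymap (fun K x => Der (a K x) (b K x)).
Proof.
move=> pa pb.
case=> [t|]; last exact: (polyfun_nat 0).
apply: polyfun_sum => s; apply: polyfunM; first exact: pb.
apply: polyfun_sum => v; apply: polyfunM; first exact: pa.
by apply: polyfun_prod => w; exact: polyfun_nat.
Qed.

Lemma polymap_one : polymap (fun K (x : I -> K) => tm_one K).
Proof. by move=> t; exact: polyfun_nat. Qed.

Lemma polymapD a b : polymap a -> polymap b -> polymap (fun K x => a K x + b K x).
Proof. by move=> pa pb t; apply: polyfunD; [exact: pa|exact: pb]. Qed.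

Lemma polymapB a b : polymap a -> polymap b -> polymap (fun K x => a K x - b K x).
Proof. by move=> pa pb t; apply: polyfunB; [exact: pa|exact: pb]. Qed.

Lemma polymap_inv a : polymap a -> polymap (fun K x => tm_inv (a K x)).
Proof.
move=> pa t; have H : polymap (fun K x => iter (tsize t).+1
    (fun c s => tm_one K s - mul_rest (a K x) c s) (fun=> 0)).
  apply: (@polymap_iter _ (fun K x c s => tm_one K s - mul_rest (a K x) c s)) => g pg s.
  apply: polyfunB; first exact: polyfun_nat.
  by apply: polyfunB; [exact: polymap_mul|exact: pg].
exact: H.
Qed.

Lemma polymap_exp_coef a k : polymap a -> polymap (fun K x => exp_coef (a K x) k).
Proof.
move=> pa; elim: k => [|k IH]; first exact: polymap_one.
move=> t; apply: polyfunM; first exact: polyfun_natV.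
exact: polymap_Der.
Qed.

Lemma polymap_tm_exp a : polymap a -> polymap (fun K x => tm_exp (a K x)).
Proof.
move=> pa t; have [e eE] : polyfun (fun K x =>
    \sum_(k <- index_enum 'I_(tsize t).+1) exp_coef (a K x) k t).
  by apply: polyfun_sum => k; exact: polymap_exp_coef.
exists e => K x; rewrite -eE /tm_exp horner_poly.
by apply: eq_bigr => k _; rewrite expr1n mulr1.
Qed.

Lemma polymap_tm_log a : polymap a -> polymap (fun K x => tm_log (a K x)).
Proof.
move=> pa t; have H : polymap (fun K x => iter (tsize t).+1
    (fun c s => (a K x s - tm_one K s) - exp_rest c s) (fun=> 0)).
  apply: (@polymap_iter _ (fun K x c s => (a K x s - tm_one K s) - exp_rest c s)) => g pg s.
  apply: polyfunB; first by apply: polyfunB; [exact: pa|exact: polyfun_nat].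
  case: s => [s|]; last exact: (polyfun_nat 0).
  by apply: polyfunB; [exact: polymap_tm_exp|exact: pg].
exact: H.
Qed.

End Polyfun.

(** * Smoothness of polynomial maps by symbolic differentiation *)

Section Smooth.
Variables (K : numFieldType) (I J : Type).

(** The variable [(0, i)] is a coordinate of the point, [(m.+1, i)] a coordinate of the direction
    [p m]. *)
Definition penv (x : I -> K) (p : nat -> I -> K) (v : nat * I) : K :=
  if v.1 is m.+1 then p m v.2 else x v.2.

(** Directions are held fixed under differentiation, so only the variables of the point have a
    derivative. *)
Definition pdir m (v : nat * I) : option (nat * I) :=
  if v.1 is 0%N then Some (m.+1, v.2) else None.

Fixpoint pderivs m n (e : pexp (nat * I)) : pexp (nat * I) :=
  if n is n.+1 then pderivs m.+1 n (pderiv (pdir m) e) else e.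

Lemma diff_quot_peval (f : (I -> K) -> (J -> K)) (E : J -> pexp (nat * I)) p m x :
  (forall x j, f x j = peval (E j) (penv x p)) ->
  diff_quot f (p m) x @ 0^' --> (fun j => peval (pderiv (pdir m) (E j)) (penv x p)).
Proof.
move=> fE; apply: cvg_coord => j.
pose y (v : nat * I) := if v.1 is 0%N then p m v.2 else 0.
pose q := pline (E j) (penv x p) y.
have yE v : y v = if pdir m v is Some w then penv x p w else 0.
  by case: v => -[].
have [_ <-] := coef_pline (E j) yE.
rewrite (_ : (fun h => _) = (fun h : K => h^-1 * (q.[h] - q.[0]))).
  exact: poly_diff_quot.
apply/funext => h; rewrite /diff_quot /= -[LHS]/(h^-1 * (f _ j - f _ j)) !fE !horner_pline.
congr (_ * (_ - _)); congr peval; apply/funext => -[[|k] i] //=.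
- by rewrite /penv /= mulr0 addr0.
- by rewrite /penv /= mul0r addr0.
- by rewrite /penv /= mulr0 addr0.
Qed.

Lemma dderivE (f : (I -> K) -> (J -> K)) v x l :
  diff_quot f v x @ 0^' --> l -> dderiv f v x = l.
Proof.
move=> fl; have : diff_quot f v x @ 0^' --> dderiv f v x.
  by apply: (@getPex _ [set l : J -> K | diff_quot f v x @ 0^' --> l]); eexists; exact: fl.
by move=> /(cvg_unique (@pointwise_hausdorff J K) fl) <-.
Qed.

Lemma dderiv_peval (f : (I -> K) -> (J -> K)) (E : J -> pexp (nat * I)) p m x j :
  (forall x j, f x j = peval (E j) (penv x p)) ->
  dderiv f (p m) x j = peval (pderiv (pdir m) (E j)) (penv x p).
Proof.
by move=> fE; rewrite (dderivE (diff_quot_peval (m := m) (x := x) fE)).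
Qed.

Lemma iter_dderiv_peval vs m (f : (I -> K) -> (J -> K)) (E : J -> pexp (nat * I)) p :
  (forall x j, f x j = peval (E j) (penv x p)) ->
  (forall l, (l < size vs)%N -> nth 0 vs l = p (m + l)%N) ->
  forall x j, iter_dderiv f vs x j = peval (pderivs m (size vs) (E j)) (penv x p).
Proof.
elim: vs m f E => [|v vs IH] m f E fE vsE x j /=; first exact: fE.
apply: (IH m.+1 _ (fun j => pderiv (pdir m) (E j))).
  have -> : v = p m by have := vsE 0%N isT; rewrite addn0.
  by move=> x' j'; exact: dderiv_peval.
by move=> l lvs; have := vsE l.+1 lvs; rewrite addnS addSn.
Qed.

Lemma peval_continuous (T : topologicalType) (V : Type) (e : pexp V) (x : T -> V -> K) :
  (forall v, continuous (fun t => x t v)) -> continuous (fun t => peval e (x t)).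
Proof.
move=> xc; elim: e => /= [q|v|e1 IH1 e2 IH2|e1 IH1 e2 IH2] t.
- exact: cst_continuous.
- exact: xc.
- exact: (@continuousD K K T _ _ t (IH1 t) (IH2 t)).
- exact: (@continuousM K T _ _ t (IH1 t) (IH2 t)).
Qed.

Lemma smooth_peval (f : (I -> K) -> (J -> K)) (E : J -> pexp I) F U :
  (forall x j, f x j = peval (E j) x) -> smooth F U f.
Proof.
move=> fE k; pose E0 j := psubst (fun i => PVar (0%N, i)) (E j).
have f0 p x j : f x j = peval (E0 j) (penv x p) by rewrite fE peval_subst.
split=> [x v vs _ _ _|].
  (* The default value [v] of [nth] makes direction number [size (codom vs)] equal to [v], so that
     one environment holds the earlier directions and the new one. *)
  pose p m := nth v (codom vs) m.
  have vp : v = p (size (codom vs)) by rewrite /p nth_default.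
  rewrite [in diff_quot _ v]vp.
  exists (fun j => peval (pderiv (pdir (size (codom vs)))
    (pderivs 0 (size (codom vs)) (E0 j))) (penv x p)).
  apply: (@diff_quot_peval _ (fun j => pderivs 0 (size (codom vs)) (E0 j))).
  move=> x' j; apply: iter_dderiv_peval; first exact: f0.
  by move=> l lvs; rewrite /p; exact: set_nth_default.
suff Dc : continuous (fun p : (I -> K) * ('I_k -> I -> K) =>
    iter_dderiv f (codom p.2) p.1) by exact: continuous_subspaceT Dc.
move=> p; apply: (@cvg_coord _ J K (nbhs p)) => j.
pose P (q : (I -> K) * ('I_k -> I -> K)) m := nth 0 (codom q.2) m.
have itE q : iter_dderiv f (codom q.2) q.1 j = peval (pderivs 0 k (E0 j)) (penv q.1 (P q)).
  have sq : size (codom q.2) = k by rewrite size_codom card_ord.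
  rewrite -[X in pderivs 0 X]sq.
  by apply: (iter_dderiv_peval (E := E0)) => // x' j'; exact: f0.
rewrite (_ : (fun q => _) = fun q => peval (pderivs 0 k (E0 j)) (penv q.1 (P q))); last first.
  by apply/funext => q; exact: itE.
rewrite itE.
apply: (@peval_continuous _ _ _ (fun q => penv q.1 (P q))) => -[[|m] i]; rewrite /penv /=.
  by apply: coord_comp_continuous => q; exact: cvg_fst.
(* Direction variables beyond the [k] given ones read the default value 0, hence are constant. *)
have [mk|km] := ltnP m k; last first.
  rewrite (_ : (fun q => _) = fun=> 0); first exact: cst_continuous.
  by apply/funext => q; rewrite /P nth_default// size_codom card_ord.
rewrite (_ : (fun q => _) = fun q : (I -> K) * ('I_k -> I -> K) => q.2 (Ordinal mk) i); last first.
  apply/funext => q; rewrite /P codomE (nth_map (Ordinal mk)) ?size_enum_ord//.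
  by congr (q.2 _ i); apply: val_inj; rewrite /= nth_enum_ord.
apply: (@coord_comp_continuous _ _ _ (fun q : (I -> K) * ('I_k -> I -> K) => q.2 (Ordinal mk))).
by apply: (@coord_comp_continuous _ _ (I -> K) snd) => q; exact: cvg_snd.
Qed.

End Smooth.

Lemma polymap_exprs (I J : Type) (f : forall K : numFieldType, (I -> K) -> (J -> K)) :
  polymap f -> exists E : J -> pexp I, forall K x j, f K x j = peval (E j) x.
Proof. by move=> /choice[E fE]; exists E => K x j; exact: fE. Qed.

Section AnalyticPoly.
Variable R : realType.

Lemma peval_cplx (I : Type) (e : pexp I) (x : I -> R) :
  peval e (cplx_of x) = (peval e x)%:C%C.
Proof.
elim: e => /= [q|v|e1 IH1 e2 IH2|e1 IH1 e2 IH2] //.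
- exact/esym/(fmorph_rat (real_complex R)).
- by rewrite IH1 IH2 -(rmorphD (real_complex R)).
- by rewrite IH1 IH2 -(rmorphM (real_complex R)).
Qed.

(** The extension is the same expression evaluated in [R[i]], on the whole complexification; [F 0]
    puts real points into it, as their imaginary part is 0. *)
Lemma analytic_polymap (I J : Type)
    (f : forall K : numFieldType, (I -> K) -> (J -> K))
    (g : (I -> R) -> (J -> R)) (F U : set (I -> R)) (F' : set (J -> R)) :
  polymap f -> g = f R -> F 0 -> U `<=` F ->
  (forall z, complexify F z -> complexify F' (f (cplx R) z)) ->
  analytic F U F' g.
Proof.
move=> /polymap_exprs[E fE] -> F0 UF fF; exists (complexify F), (f (cplx R)); split.
- by exists setT; [exact: openT|rewrite setIT].
- move=> x Ux; split; last by apply/funext => j; rewrite fE peval_cplx -fE.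
  by split; [exact: UF|exact: F0].
- exact: fF.
- by apply: smooth_peval => x j; exact: fE.
Qed.

End AnalyticPoly.

Lemma polyfun_continuous (I : Type) (K : numFieldType)
    (f : forall K : numFieldType, (I -> K) -> K) : polyfun f -> continuous (f K).
Proof.
move=> [e fE]; have -> : f K = peval e by apply/funext => x; exact: fE.
by apply: (@peval_continuous K (I -> K) I e id) => i x; apply: (@pointwise_continuous I K i x).
Qed.

Lemma closed_zeros (P I : Type) (K : numFieldType)
    (f : P -> forall K : numFieldType, (I -> K) -> K) :
  (forall p, polyfun (f p)) -> closed [set x : I -> K | forall p, f p K x = 0].
Proof.
move=> pf; rewrite (_ : mkset _ = \bigcap_(p in setT) (f p K @^-1` [set 0])).
  apply: closed_bigI => p _; apply: preimage_closed.
    by move=> x _; exact: polyfun_continuous.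
  by apply: accessible_closed_set1; exact/hausdorff_accessible/norm_hausdorff.
by apply/seteqP; split => x H p => [_|]; exact: H.
Qed.

(** * The Lie group of symplectic tree maps *)

Lemma S_TME (A : comNzRingType) (a : rtree0 -> A) : S_TM a <-> symplectic a.
Proof.
split=> -[a1 a0]; split=> // u w; have := a0 u w; by rewrite /phi !butcherE.
Qed.

Section SymplecticLieGroup.
Variable R : realType.
Notation T := (rtree0 -> R).

Definition hamiltonian_set : set T := [set v | hamiltonian v].
Lemma complexify_model z :
  complexify (@tm_model R) z <-> @tm_model (cplx R) z.
Proof.
rewrite /complexify /tm_model /=; split=> [[]|->//].
by case: (z None) => a b /= -> ->.
Qed.

(** [psi] is linear with real coefficients, hence acts separately on real and imaginary parts. Thus
    complex extensions land in the right space by the same algebra over [R[i]]. *)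
Lemma complexify_hamiltonian z : complexify hamiltonian_set z <-> hamiltonian (z : rtree0 -> cplx R).
Proof.
have psiE u w : psi z u w =
    (psi (fun i => complex.Re (z i)) u w +i* psi (fun i => complex.Im (z i)) u w)%C.
  by rewrite /psi; case: (z _) => a b; case: (z _).
split=> [[[a1 a0] [b1 b0]]|[z1 z0]].
  split; first by apply/complexify_model.
  by move=> u w; rewrite psiE a0 b0.
have /complexify_model[? ?] : tm_model z by [].
by split; split=> // u w; have := z0 u w; rewrite psiE => -[].
Qed.

Lemma hamiltonian_model v : hamiltonian_set v -> tm_model v.
Proof. by case. Qed.

Lemma hamiltonian_submod (h : R) x y : hamiltonian_set x -> hamiltonian_set y ->
  hamiltonian_set (h *: x + y).
Proof.
move=> [x1 x0] [y1 y0]; split.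
  by rewrite -[LHS]/(h * x None + y None) x1 y1 mulr0 addr0.
move=> u w; have := x0 u w; have := y0 u w; rewrite /psi => E1 E2.
rewrite -[LHS]/((h * x _ + y _) + (h * x _ + y _)).
by rewrite addrACA -mulrDr E2 E1 mulr0 addr0.
Qed.

Lemma hamiltonian0 : hamiltonian_set 0.
Proof. by split=> // u w; rewrite /psi addr0. Qed.

Lemma closed_subspace_hamiltonian : closed_subspace hamiltonian_set.
Proof.
split; [|exact: hamiltonian0|exact: hamiltonian_submod].
(* The index [None] stands for the condition [v None = 0], so that all conditions form one
   family. *)
pose f (p : option (rtree * rtree)) (K : numFieldType) (v : rtree0 -> K) :=
  if p is Some (u, w) then v (Some (bt u w)) + v (Some (bt w u)) else v None.
rewrite (_ : hamiltonian_set = [set v | forall p, f p R v = 0]).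
  apply: closed_zeros => -[[u w]|]; last exact: polyfun_var.
  by apply: polyfunD; exact: polyfun_var.
apply/seteqP; split=> [v [v1 v0] [[u w]|]//|v v0]; first exact: v0.
by split=> [|u w]; [exact: (v0 None)|exact: (v0 (Some (u, w)))].
Qed.

Lemma closed_S_TM : closed_in (@G_TM R) (@S_TM R).
Proof.
pose f (p : rtree * rtree) (K : numFieldType) (a : rtree0 -> K) :=
  a (Some (bt p.1 p.2)) + a (Some (bt p.2 p.1)) - a (Some p.1) * a (Some p.2).
exists [set a | forall p, f p R a = 0].
  apply: closed_zeros => p; apply: polyfunB; first by apply: polyfunD; exact: polyfun_var.
  by apply: polyfunM; exact: polyfun_var.
apply/seteqP; split=> a; first by move=> /S_TME[a1 a0]; split=> // p; exact: a0.
by move=> [a1 a0]; apply/S_TME; split=> // u w; exact: (a0 (u, w)).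
Qed.

Lemma open_in_self (X : topologicalType) (A : set X) : open_in A A.
Proof. by exists setT; [exact: openT|rewrite setIT]. Qed.

Lemma subgroup_S_TM : subgroup (@tm_mul R) (@tm_one R) (@G_TM R) (@S_TM R).
Proof.
split.
- by move=> a [].
- exact/S_TME/symplectic_one.
- by move=> a b /S_TME sa /S_TME sb; apply/S_TME/symplectic_mul.
- move=> a /S_TME sa; exists (tm_inv a); first exact/S_TME/symplectic_inv.
  by split; [exact: tm_mulV|apply: tm_mulVl; case: sa].
Qed.

Definition log_chart : chart R rtree0 := Chart (@G_TM R) (@tm_log R) (@tm_exp R).

Lemma tm_log_image : @tm_log R @` @G_TM R = @tm_model R.
Proof.
apply/seteqP; split=> [_ [a a1 <-]|v v0]; first exact: tm_log_None.
by exists (tm_exp v); [exact: tm_exp_None|exact: tm_expK].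
Qed.

Lemma polymap_id I : polymap (fun K (x : I -> K) => x).
Proof. by move=> i; exact: polyfun_var. Qed.

Lemma analytic_diffeo_log :
  analytic_diffeo (butcher_group R) (@G_TM R) (linear_manifold (@tm_model R))
    (@tm_model R) (@tm_log R) (@tm_exp R).
Proof.
split.
- by move=> a a1; split; [exact: tm_log_None|exact: tm_logK].
- by move=> v v0; split; [exact: tm_exp_None|exact: tm_expK].
- move=> a a1; exists (Chart (@G_TM R) (fun a => a - @tm_one R) (fun a => a + @tm_one R)).
  exists (Chart (@tm_model R) id id), (@G_TM R); split=> //.
  + by split=> //; exact: open_in_self.
  + by move=> b b1; exact: tm_log_None.
  apply: (@analytic_polymap R _ _ (fun K x => tm_log (x + @tm_one K))) => //.
  + by apply: polymap_tm_log; apply: polymapD; [exact: polymap_id|exact: polymap_one].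
  + move=> _ [b b1 <-]; suff : b None - tm_one R None = 0 by [].
    by rewrite b1 subrr.
  + move=> z /complexify_model z0; apply/complexify_model; apply: tm_log_None.
    suff : z None + 1 = 1 by [].
    by rewrite z0 add0r.
- move=> v v0; exists (Chart (@tm_model R) id id).
  exists (Chart (@G_TM R) (fun a => a - @tm_one R) (fun a => a + @tm_one R)), (@tm_model R).
  split=> //.
  + by split=> //; exact: open_in_self.
  + by move=> b b1; exact: tm_exp_None.
  apply: (@analytic_polymap R _ _ (fun K x => tm_exp x - @tm_one K)) => //.
  + by apply: polymapB; [apply: polymap_tm_exp; exact: polymap_id|exact: polymap_one].
  + by move=> _ [b b1 <-].
  + move=> z /complexify_model z0; apply/complexify_model.
    suff : tm_exp z None - 1 = 0 by [].
    by rewrite tm_exp_None subrr.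
Qed.

Lemma tm_log_image_S : @tm_log R @` (@G_TM R `&` @S_TM R) = @tm_model R `&` hamiltonian_set.
Proof.
apply/seteqP; split=> [_ [a [a1 /S_TME sa] <-]|v [v0 hv]].
  by split; [exact: tm_log_None|exact: hamiltonian_tm_log].
exists (tm_exp v); last exact: tm_expK.
by split; [exact: tm_exp_None|exact/S_TME/symplectic_tm_exp].
Qed.

Lemma slice_chart_log : slice_chart (butcher_group R) (@S_TM R) hamiltonian_set log_chart.
Proof.
rewrite /slice_chart /= tm_log_image; split.
- exact: open_in_self.
- exact: open_in_self.
- exact: analytic_diffeo_log.
- exact: tm_log_image_S.
Qed.

Lemma closed_Lie_subgroup_S_TM :
  closed_Lie_subgroup (@tm_mul R) (@tm_one R) (butcher_group R) (@S_TM R) hamiltonian_set.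
Proof.
split; [exact: subgroup_S_TM|exact: closed_S_TM|split].
- by move=> a [].
- exact: closed_subspace_hamiltonian.
- exact: hamiltonian_model.
- by move=> a [a1 _]; exists log_chart => //; exact: slice_chart_log.
Qed.

Definition S_manifold : manifold R rtree0 :=
  induced_manifold (butcher_group R) (@S_TM R) hamiltonian_set.

Definition log_chart_S : chart R rtree0 :=
  Chart (@G_TM R `&` @S_TM R) (@tm_log R) (@tm_exp R).

Lemma atlas_log : atlas S_manifold log_chart_S.
Proof. by exists log_chart => //; exact: slice_chart_log. Qed.

Lemma log_chart_S_dom a : @S_TM R a -> cdom log_chart_S a.
Proof. by move=> Sa; split=> //; case: Sa. Qed.

(** In the logarithmic chart the multiplication is the Baker--Campbell--Hausdorff product
    [log (exp x exp y)]. Its extension preserves the Hamiltonian condition because [symplectic_mul]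
    holds over [R[i]] as well; likewise for the inversion. *)
Lemma analytic_Lie_group_S : analytic_Lie_group (@tm_mul R) (@tm_one R) S_manifold.
Proof.
have [_ S1 SM SV] := subgroup_S_TM.
exists (@tm_inv R); split.
- split.
  + by split.
  + by move=> a b c _ [b1 _] _; exact: tm_mulA.
  + by move=> a [a1 _]; split; [exact: tm_mul1|exact: tm_mulr1].
  + move=> a Sa; have [a1 _] := Sa; split; [|exact: tm_mulVl|exact: tm_mulV].
    by apply/S_TME/symplectic_inv/S_TME.
- move=> GG z [Sz1 Sz2]; exists (product_chart log_chart_S log_chart_S), log_chart_S.
  exists (carrier (product_manifold S_manifold S_manifold)); split.
  + by exists log_chart_S, log_chart_S; split=> //; exact: atlas_log.
  + exact: atlas_log.
  + split=> //; first exact: open_in_self.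
    by move=> y [/= Sy1 Sy2]; split; exact: log_chart_S_dom.
  + by move=> y [/= Sy1 Sy2]; apply: log_chart_S_dom; exact: SM.
  apply: (@analytic_polymap R _ _
    (fun K x => tm_log (tm_mul (tm_exp (x \o inl)) (tm_exp (x \o inr))))) => //.
  + apply: polymap_tm_log; apply: polymap_mul; apply: polymap_tm_exp => t; exact: polyfun_var.
  + by split; exact: hamiltonian0.
  + move=> _ [y [/= /S_TME Sy1 /S_TME Sy2] <-]; split; exact: hamiltonian_tm_log.
  move=> x [[x1 x2] [y1 y2]]; apply/complexify_hamiltonian/hamiltonian_tm_log/symplectic_mul;
    by apply/symplectic_tm_exp/complexify_hamiltonian.
- move=> a Sa; exists log_chart_S, log_chart_S, (@S_TM R); split.
  + exact: atlas_log.
  + exact: atlas_log.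
  + by split=> //; [exact: open_in_self|exact: log_chart_S_dom].
  + by move=> b /S_TME Sb; apply: log_chart_S_dom; apply/S_TME/symplectic_inv.
  apply: (@analytic_polymap R _ _ (fun K x => tm_log (tm_inv (tm_exp x)))) => //.
  + by apply: polymap_tm_log; apply: polymap_inv; apply: polymap_tm_exp; exact: polymap_id.
  + exact: hamiltonian0.
  + by move=> _ [b /S_TME Sb <-]; exact: hamiltonian_tm_log.
  + move=> z /complexify_hamiltonian hz; apply/complexify_hamiltonian/hamiltonian_tm_log/symplectic_inv.
    exact: symplectic_tm_exp.
Qed.

(** * Lie algebra, evolution equation and exponential map *)

Lemma tm_log_one : tm_log (@tm_one R) = 0.
Proof.
rewrite -[RHS](@tm_expK R 0)//; congr tm_log; apply/funext => t.
rewrite -(flow0 0 t) -tm_exp_scale; congr (tm_exp _ t).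
by apply/funext => s; rewrite mul0r.
Qed.

Lemma diff_quot_tm_exp (w : T) : w None = 0 ->
  diff_quot (@tm_exp R) w (tm_log (@tm_one R)) @ 0^' --> w.
Proof.
move=> w0; rewrite tm_log_one; apply: cvg_coord => t.
rewrite -(exp_coef1 t w0) -coef_flow.
rewrite (_ : (fun h => _) = (fun h => h^-1 * ((flow w t).[h] - (flow w t).[0]))).
  exact: poly_diff_quot.
apply/funext => h; rewrite -!tm_exp_scale; congr (_ * (tm_exp _ t - tm_exp _ t)); apply/funext => s.
  exact: add0r.
by rewrite mul0r.
Qed.

Lemma line_continuous (p w : T) : continuous (fun h : R => p + h *: w).
Proof.
move=> h; apply: (@cvg_coord _ _ _ (nbhs h)) => i.
have -> : (fun x : R => (p + x *: w) i) = horner ((p i)%:P + w i *: 'X).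
  by apply/funext => x; rewrite hornerD hornerC hornerZ hornerX mulrC.
have := @horner_continuous R ((p i)%:P + w i *: 'X) h.
by rewrite /continuous_at hornerD hornerC hornerZ hornerX mulrC.
Qed.

(* A tangent vector is a limit of difference quotients along a curve in S_TM, in
   which the symplectic condition is, up to the factor h, that of hamiltonian_set. *)
Lemma Lie_algebra_S : Lie_algebra (@tm_one R) S_manifold = hamiltonian_set.
Proof.
apply/seteqP; split=> [v|v hv]; last first.
  exists log_chart_S; split; first exact: atlas_log.
    by apply: log_chart_S_dom; exact/S_TME/symplectic_one.
  by exists v => //; apply: diff_quot_tm_exp; case: hv.
move=> [_ [[c sc <-] /= [D1 S1] [w hw qv]]].
have [_ [W Wopen VW] [cK _ _ _] cS] := sc.
have S1F : (cfun c @` cdom c `&` hamiltonian_set) (cfun c (@tm_one R)).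
  by rewrite -cS; exists (@tm_one R).
have [_ p_ham] := S1F.
have Wp : W (cfun c (@tm_one R)).
  have : (cfun c @` cdom c) (cfun c (@tm_one R)) by exists (@tm_one R).
  by rewrite VW => -[].
(* For small [h] the line stays in the open image of the chart, and it lies in the model subspace;
   the slice property pulls it back to a curve in [S_TM]. *)
have curve : \forall h \near (0 : R)^', @S_TM R (cinv c (cfun c (@tm_one R) + h *: w)).
  have : \forall h \near (0 : R), W (cfun c (@tm_one R) + h *: w).
    have := @line_continuous (cfun c (@tm_one R)) w 0; apply.
    by apply: open_nbhs_nbhs; split=> //; rewrite scale0r addr0.
  move=> Wn; near=> h.
  have Wh : W (cfun c (@tm_one R) + h *: w) by near: h; exact: cvg_within Wn.
  have ph : hamiltonian_set (cfun c (@tm_one R) + h *: w) by rewrite addrC; exact: hamiltonian_submod.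
  have : (cfun c @` (cdom c `&` @S_TM R)) (cfun c (@tm_one R) + h *: w).
    by rewrite cS; split=> //; rewrite VW; split=> //; exact: hamiltonian_model.
  by move=> [a [Da Sa] <-]; have [_ ->] := cK a Da.
have [_ c1] := cK _ D1.
pose q := diff_quot (cinv c) w (cfun c (@tm_one R)).
have qE h t : h != 0 -> cinv c (cfun c (@tm_one R) + h *: w) t = tm_one R t + h * q h t.
  move=> h0; rewrite /q /diff_quot c1 -[X in h * X]/(h^-1 * (_ - _)) mulrA mulfV//.
  by rewrite mul1r [RHS]addrC subrK.
have qc t : (fun h => q h t) @ 0^' --> v t by exact: (@cvg_coordE _ _ _ _ q v t _ qv).
have lim0 (f : R -> R) (x y : R) : f @ 0^' --> x ->
    (\forall h \near (0 : R)^', f h = y) -> x = y.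
  move=> fx fy; apply: (cvg_unique (@norm_hausdorff R R) fx).
  apply: (@cvg_trans _ ((fun=> y) @ (0 : R)^')); last exact: cvg_cst.
  by apply: near_eq_cvg; apply: filterS fy => h ->.
split.
  apply: (lim0 _ _ _ (qc None)); near=> h.
  have h0 : h != 0 by near: h; exact: nbhs_dnbhs_neq.
  have [+ _] : @S_TM R (cinv c (cfun c (@tm_one R) + h *: w)) by near: h.
  rewrite /G_TM /= qE// => /eqP; rewrite -subr_eq0 addrAC subrr add0r mulf_eq0.
  by rewrite (negbTE h0) => /eqP.
move=> s r; have id0 : (fun h : R => h) @ 0^' --> (0 : R) by exact: cvg_within.
(* [h * f h] is [phi] of the curve at [(s, r)], because [e] vanishes on non-empty trees; the
   quadratic term of [f] disappears in the limit. *)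
pose f h := q h (Some (bt s r)) + q h (Some (bt r s)) - h * (q h (Some s) * q h (Some r)).
have fl : f @ 0^' --> v (Some (bt s r)) + v (Some (bt r s)) - 0 * (v (Some s) * v (Some r)).
  exact: (cvgB (cvgD (qc (Some (bt s r))) (qc (Some (bt r s))))
    (cvgM id0 (cvgM (qc (Some s)) (qc (Some r))))).
have := lim0 f _ 0 fl; rewrite mul0r subr0; apply; near=> h.
have h0 : h != 0 by near: h; exact: nbhs_dnbhs_neq.
have /S_TME[_ /(_ s r)] : @S_TM R (cinv c (cfun c (@tm_one R) + h *: w)) by near: h.
rewrite /phi !qE// !add0r => E; apply: (mulfI h0); rewrite mulr0 -[RHS]E /f.
by ring.
Unshelve. all: by end_near. Qed.

Lemma dderiv_mul (v b : T) : dderiv (fun x => tm_mul x b) v (@tm_one R) = Der v b.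
Proof.
apply: dderivE; apply: cvg_coord => t; pose q := tm_mul (eps v) (polyC \o b) t.
rewrite DerE (_ : (fun h => _) = (fun h : R => h^-1 * (q.[h] - q.[0]))).
  exact: poly_diff_quot.
have qE h : q.[h] = tm_mul (@tm_one R + h *: v) b t.
  rewrite -[LHS](tm_mul_morph (horner_eval h)); congr (tm_mul _ _ t); apply/funext => s.
    by rewrite /= /horner_eval hornerD hornerC hornerZ hornerX mulrC.
  by rewrite /= /horner_eval hornerC.
by apply/funext => h; rewrite !qE scale0r addr0.
Qed.

Lemma evolution_flow v : hamiltonian v ->
  evolution (@tm_mul R) (@tm_one R) S_manifold v (fun x t => (flow v t).[x]).
Proof.
move=> hv; split.
- by move=> x; apply/S_TME; exact: symplectic_flow.
- by apply/funext => t; exact: flow0.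
move=> x; rewrite dderiv_mul; apply: cvg_coord => t.
(* Translating time by [x] turns the derivative at [x] into the coefficient of [X]. *)
pose q := flow v t \Po ('X + x%:P).
have -> : Der v (fun t => (flow v t).[x]) t = q`_1.
  have -> : q`_1 = (q^`())`_0 by rewrite coef_deriv mulr1n.
  rewrite -horner_coef0 deriv_comp derivD derivX derivC addr0 mulr1 horner_comp.
  rewrite hornerD hornerX hornerC add0r deriv_flow.
  rewrite -[RHS](Der_morph (horner_eval x)); congr (Der _ _ t); apply/funext => s.
  by rewrite /= /horner_eval hornerC.
rewrite (_ : (fun h => _) = (fun h => h^-1 * (q.[h] - q.[0]))).
  exact: poly_diff_quot.
apply/funext => h; rewrite /q !horner_comp !hornerD !hornerX !hornerC add0r.
by rewrite [h + x]addrC.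
Qed.

(** Induction on the size of the tree: by [Der_local] the value of [Der v b] at [t] does not depend
    on [b t], so two solutions have equal derivatives at [t] and differ by a constant, which is 0 at
    time 0. *)
Lemma evolution_unique v eta eta' :
  evolution (@tm_mul R) (@tm_one R) S_manifold v eta ->
  evolution (@tm_mul R) (@tm_one R) S_manifold v eta' -> eta = eta'.
Proof.
move=> [eG e0 eD] [eG' e0' eD']; apply/funext => x; apply/funext => t.
have [n] := ubnP (tsize t); elim: n t x => // n IH t x tn.
have DE y : Der v (eta y) t = Der v (eta' y) t.
  case: t tn => [t|//] tn.
  have agree s : (tsize s < tsize (Some t))%N -> eta y s = eta' y s.
    by move=> st; apply: IH; exact: leq_trans st _.
  have := @Der_local R v v (eta y) (eta' y) t (fun _ _ => erefl) agree.
  by rewrite (agree None) ?tsize_gt0// => /addIr.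
suff : eta x t - eta' x t = eta 0 t - eta' 0 t.
  by rewrite e0 e0' subrr => /eqP; rewrite subr_eq0 => /eqP.
apply: (@is_derive_0_is_cst R (fun y => eta y t - eta' y t)) => y.
have dl : (fun h : R => h^-1 *: (((fun y => eta y t - eta' y t) \o shift y) (h *: (1 : R)) -
    (eta y t - eta' y t))) @ 0^' --> (0 : R).
  pose g h := h^-1 * (eta (y + h) t - eta y t) - h^-1 * (eta' (y + h) t - eta' y t).
  have gl : g @ 0^' --> (0 : R).
    rewrite -[X in _ --> X](subrr (Der v (eta y) t)) {2}DE -!dderiv_mul.
    exact: (cvgB (@cvg_coordE _ _ _ _ _ _ t _ (eD y)) (@cvg_coordE _ _ _ _ _ _ t _ (eD' y))).
  rewrite (_ : (fun h : R => _) = g)//; apply/funext => h; rewrite /g /= /shift /=.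
  rewrite -[LHS]/(h^-1 * (eta (h * 1 + y) t - eta' (h * 1 + y) t - (eta y t - eta' y t))).
  by rewrite mulr1 [h + y]addrC; ring.
apply: DeriveDef; first exact: cvgP dl.
exact: (cvg_lim (@norm_hausdorff R R) dl).
Qed.

Lemma exponential_map_tm_exp : exponential_map (@tm_mul R) (@tm_one R) S_manifold (@tm_exp R).
Proof.
rewrite /exponential_map Lie_algebra_S => v hv a; split=> [[eta ev <-]|->].
  by rewrite (evolution_unique ev (evolution_flow hv)).
by exists (fun x t => (flow v t).[x]); first exact: evolution_flow.
Qed.

(** In the chart [log_chart_S] both maps read [tm_log (tm_exp x)], so that one polynomial family
    serves for either direction. *)
Lemma analytic_diffeo_tm_exp :
  analytic_diffeo (linear_manifold hamiltonian_set) hamiltonian_set S_manifold (@S_TM R)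
    (@tm_exp R) (@tm_log R).
Proof.
have lgex v : hamiltonian_set v -> tm_log (tm_exp v) = v by move=> [v0 _]; exact: tm_expK.
split.
- by move=> v hv; split; [exact/S_TME/symplectic_tm_exp|exact: lgex].
- by move=> a Sa; have [a1 _] := Sa; split; [exact/hamiltonian_tm_log/S_TME|exact: tm_logK].
- move=> v hv; exists (Chart hamiltonian_set id id), log_chart_S, hamiltonian_set; split=> //.
  + exact: atlas_log.
  + by split=> //; exact: open_in_self.
  + by move=> w hw; apply: log_chart_S_dom; exact/S_TME/symplectic_tm_exp.
  apply: (@analytic_polymap R _ _ (fun K x => tm_log (tm_exp x))) => //.
  + by apply: polymap_tm_log; apply: polymap_tm_exp; exact: polymap_id.
  + exact: hamiltonian0.
  + by move=> _ [w hw <-].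
  + move=> z /complexify_hamiltonian hz; apply/complexify_hamiltonian/hamiltonian_tm_log.
    exact: symplectic_tm_exp.
- move=> a Sa; exists log_chart_S, (Chart hamiltonian_set id id), (@S_TM R); split=> //.
  + exact: atlas_log.
  + by split=> //; [exact: open_in_self|exact: log_chart_S_dom].
  + by move=> b /S_TME Sb; exact: hamiltonian_tm_log.
  apply: (@analytic_polymap R _ _ (fun K x => tm_log (tm_exp x))) => //.
  + by apply: polymap_tm_log; apply: polymap_tm_exp; exact: polymap_id.
  + exact: hamiltonian0.
  + by move=> _ [b /S_TME Sb <-]; exact: hamiltonian_tm_log.
  + move=> z /complexify_hamiltonian hz; apply/complexify_hamiltonian/hamiltonian_tm_log.
    exact: symplectic_tm_exp.
Qed.

End SymplecticLieGroup.

Theorem theoremD (R : realType) :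
  exists F : set (rtree0 -> R),
    let S := induced_manifold (butcher_group R) (@S_TM R) F in
    [/\ closed_Lie_subgroup (@tm_mul R) (@tm_one R) (butcher_group R) (@S_TM R) F,
        BCH_Lie_group (@tm_mul R) (@tm_one R) S &
        exponential_Lie_group (@tm_mul R) (@tm_one R) S].
Proof.
exists (@hamiltonian_set R); split.
- exact: closed_Lie_subgroup_S_TM.
- split; first exact: analytic_Lie_group_S.
  (* The exponential map is a global diffeomorphism, so the whole Lie algebra and the whole group
     serve as neighbourhoods. *)
  exists (@tm_exp R), (@tm_log R), (@hamiltonian_set R), (@S_TM R).
  rewrite Lie_algebra_S; split.
  + exact: exponential_map_tm_exp.
  + by split; [exact: open_in_self|exact: hamiltonian0].
  + exact: open_in_self.
  + exact: analytic_diffeo_tm_exp.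
- exists (@tm_exp R), (@tm_log R); split; first exact: exponential_map_tm_exp.
  by rewrite Lie_algebra_S; exact: analytic_diffeo_tm_exp.
Qed.
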